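(* Let $h$ be a hauptmodul for a genus zero modular group $\Gamma$ and $t$ a hauptmodul for a genus zero modular group $\Gamma'$, and let $n$ be a positive integer. Suppose $h(\tau)$ and $h(n\tau)$ can both be expressed as rational functions of $t$, say $h(\tau) = h_1(t(\tau))$ and $h(n\tau) = h_2(t(\tau))$. Then $$h_1'(t)^2\, Q_\Gamma(h_1(t)) + \tfrac{1}{2}\{h_1(t),t\} \;=\; h_2'(t)^2\, Q_\Gamma(h_2(t)) + \tfrac{1}{2}\{h_2(t),t\} \;=\; Q_{\Gamma'}(t).$$
   Context: A genus zero modular group $\Gamma$ is a discrete subgroup of $\mathrm{PSL}(2,\mathbb{R})$ acting on the upper half plane $\mathbb{H}$ (commensurable with $\mathrm{PSL}(2,\mathbb{Z})$) whose compactified quotient $\Gamma\backslash\mathbb{H}$ has genus $0$; a hauptmodul for $\Gamma$ is a $\Gamma$-invariant meromorphic function on $\mathbb{H}$ generating the function field of this genus zero curve. For such a hauptmodul $h$, the ''Q-value'' $Q_\Gamma$ is the rational function such that $h$ satisfies the Schwarzian differential equation $$h'(\tau)^2\, Q_\Gamma(h(\tau)) + \tfrac{1}{2}\{h(\tau),\tau\} = 0,$$ where $\{f(x),x\} = \frac{2 f'(x) f'''(x) - 3 f''(x)^2}{2 f'(x)^2}$ denotes the Schwarzian derivative. $Q_{\Gamma'}$ is defined in the same way for the hauptmodul $t$ of $\Gamma'$. *)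

(* Defs.v *)
From mathcomp Require Import all_boot all_order all_algebra.
From mathcomp Require Import all_classical all_reals all_analysis.
From mathcomp Require Import complex.
Set Implicit Arguments.
Unset Strict Implicit.
Unset Printing Implicit Defensive.
Import Order.TTheory GRing.Theory Num.Theory.
Import numFieldNormedType.Exports.
Local Open Scope ring_scope.
Local Open Scope complex_scope.
Local Open Scope classical_set_scope.

(* The complex numbers, as a numFieldType (hence a normed module over itself). *)
Definition Cplx (R : realType) : numFieldType := R[i].

Section Defs.
Variable R : realType.
Local Notation C := (Cplx R).

Definition ImC (z : C) : R := complex.Im (z : R[i]).

Definition uhp : set C := [set z | 0 < ImC z].

Definition mob (g : 'M[R]_2) (z : C) : C :=
  ((g 0 0)%:C * z + (g 0 1)%:C) / ((g 1 0)%:C * z + (g 1 1)%:C).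

Definition SL2R : set 'M[R]_2 := [set g | \det g = 1].
Definition SL2Z : set 'M[R]_2 :=
  [set g | \det g = 1 /\ forall i j, g i j \is a Num.int].

Definition is_subgroup (K : set 'M[R]_2) : Prop :=
  K 1%:M /\ (forall a b, K a -> K b -> K (a *m b)) /\
  (forall a, K a -> K (invmx a)).

Definition finite_index (K G : set 'M[R]_2) : Prop :=
  exists s : seq 'M[R]_2, (forall r, r \in s -> G r) /\
    forall g, G g -> exists2 r, r \in s & K (invmx r *m g).

(* A modular group: a subgroup of PSL_2(R) commensurable with PSL_2(Z).
   It is represented by its full preimage in SL_2(R) (hence contains -1). *)
Definition modular_group (G : set 'M[R]_2) : Prop :=
  G `<=` SL2R /\ is_subgroup G /\ G (- 1%:M) /\
  finite_index (G `&` SL2Z) G /\ finite_index (G `&` SL2Z) SL2Z.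

(* f is meromorphic on the upper half plane, with pole set P
   (values of f at points of P are irrelevant). *)
Definition meromorphic_uhp (f : C -> C) (P : set C) : Prop :=
  P `<=` uhp /\
  (forall z, uhp z -> exists2 r : C, 0 < r &
      forall w, `|w - z| < r -> w != z -> ~ P w) /\
  (forall z, uhp z -> ~ P z -> derivable f z 1) /\
  (forall p, P p -> exists m : nat, exists2 r : C, 0 < r &
      exists M : C, forall w, `|w - p| < r -> w != p ->
        `|(w - p) ^+ m * f w| <= M).

Definition invariant (G : set 'M[R]_2) (f : C -> C) (P : set C) : Prop :=
  forall g, G g -> forall z, uhp z ->
    (P (mob g z) <-> P z) /\ (~ P z -> f (mob g z) = f z).

(* Meromorphy at every cusp gamma(i oo), gamma in SL_2(Z): f(gamma tau) has
   no poles and grows at most exponentially in Im tau for Im tau large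
   (for a periodic holomorphic function this is exactly meromorphy of its
   q-expansion at q = 0). *)
Definition meromorphic_at_cusps (f : C -> C) (P : set C) : Prop :=
  forall g, SL2Z g -> exists c M Y : R, forall z, Y < ImC z ->
    ~ P (mob g z) /\ `|f (mob g z)| <= (M * expR (c * ImC z))%:C.

Definition modular_function (G : set 'M[R]_2) (f : C -> C) (P : set C) :=
  meromorphic_uhp f P /\ invariant G f P /\ meromorphic_at_cusps f P.

Definition ratf (p q : {poly C}) (x : C) : C := p.[x] / q.[x].

(* h is a hauptmodul for G: a (nonconstant) modular function for G that
   generates the field of modular functions for G, i.e. every modular
   function is a rational function of h.  The existence of such an h is
   equivalent to G having genus zero. *)
Definition hauptmodul (G : set 'M[R]_2) (h : C -> C) (Ph : set C) : Prop :=
  modular_function G h Ph /\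
  (exists z1 z2, uhp z1 /\ uhp z2 /\ ~ Ph z1 /\ ~ Ph z2 /\ h z1 != h z2) /\
  (forall f Pf, modular_function G f Pf ->
     exists p q : {poly C}, q != 0 /\
       forall z, uhp z -> ~ Ph z -> ~ Pf z -> q.[h z] != 0 ->
         f z = ratf p q (h z)).

Definition genus_zero (G : set 'M[R]_2) : Prop :=
  exists h Ph, hauptmodul G h Ph.

Definition schwarzian (f : C -> C) (x : C) : C :=
  let f1 := derive1 f in
  let f2 := derive1 f1 in
  let f3 := derive1 f2 in
  (2 * f1 x * f3 x - 3 * (f2 x) ^+ 2) / (2 * (f1 x) ^+ 2).

(* Q = QA/QB is the Q-value of h:
   h'(tau)^2 Q(h(tau)) + 1/2 {h(tau),tau} = 0 (as meromorphic functions on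
   uhp, i.e. at every point of uhp where all terms are defined). *)
Definition Qvalue (h : C -> C) (Ph : set C) (QA QB : {poly C}) : Prop :=
  QB != 0 /\
  forall z, uhp z -> ~ Ph z -> derive1 h z != 0 -> QB.[h z] != 0 ->
    (derive1 h z) ^+ 2 * ratf QA QB (h z) + 2^-1 * schwarzian h z = 0.

End Defs.

(* Main.v *)
Require Import Defs.
From mathcomp Require Import all_boot all_order all_algebra.
From mathcomp Require Import all_classical all_reals all_analysis.
From mathcomp Require Import complex.
From mathcomp Require Import ring lra.
Set Implicit Arguments.
Unset Strict Implicit.
Unset Printing Implicit Defensive.
Import Order.TTheory GRing.Theory Num.Theory.
Import numFieldNormedType.Exports.
Local Open Scope ring_scope.
Local Open Scope classical_set_scope.

(** The Schwarzian satisfies the chain rule [{r o t, z} = {r, t} t'^2 + {t, z}].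
    Applied to [h(n z) = r(t(z))], it turns the equation of [h] at [n z] and that
    of [t] at [z] into [t'(z)^2 (r'(x)^2 Q(r(x)) + {r, x}/2 - Q'(x)) = 0] at
    [x = t(z)].  As [t] takes infinitely many values at points where [t' <> 0], the
    bracket, a rational function of [x], vanishes identically.

    The chain rule needs [t] to be three times differentiable, whereas meromorphy
    only provides one complex derivative.  Regularity comes from Goursat's lemma on
    rectangles: if [f] is differentiable on a rectangle with boundary [S] and [a] is
    interior, then [f(a) J(a) = N(a)] with [N(a)] the integral of [f(z)/(z - a)] and
    [J(a)] that of [1/(z - a)] over [S].  Both can be differentiated under the
    integral sign, and [J(a)] is nonzero because each of the four sides contributes
    positively to its imaginary part; its value is never needed. *)

(** * The real-valued modulus and complex derivatives *)

Section ComplexNorm.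
Variable R : realType.
Local Open Scope complex_scope.
Local Notation C := (Cplx R).

(** The modulus of [Cplx R] takes its values in [Cplx R] itself, whose order is only partial;
    estimates therefore go through the real modulus [nrm], to which linear real arithmetic applies.
    Functions are total, with x / 0 = 0, and [derive1] of a rational function is a limit, not an
    algebraic operation. An identity of rational functions is therefore an equality off the zeros of
    one polynomial, which collects every denominator and derivative that must not vanish. The points
    that feed it come from perturbation: regularity of t(z) and of h(n z), t'(z) nonzero, and t(z)
    outside a finite list all hold on a punctured disc about one regular point of [t] with nonzero
    derivative. Both halves of the conclusion are one statement about h(n z), the first with n =
    1. *)

Definition nrm (z : C) : R := Normc.normc (z : R[i]).

Lemma normE (z : C) : `|z| = ((nrm z)%:C : R[i]).
Proof. by case: z. Qed.

Lemma nrm_ge0 (z : C) : 0 <= nrm z.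
Proof. by case: z => a b; rewrite /nrm /= sqrtr_ge0. Qed.

Lemma nrm0 : nrm 0 = 0. Proof. exact: Normc.normc0. Qed.

Lemma nrm_eq0 (z : C) : (nrm z == 0) = (z == 0).
Proof.
apply/eqP/eqP => [|->]; last exact: nrm0.
exact: Normc.eq0_normc.
Qed.

Lemma nrm_gt0 (z : C) : (0 < nrm z) = (z != 0).
Proof. by rewrite lt_def nrm_ge0 andbT nrm_eq0. Qed.

Lemma nrmM (z w : C) : nrm (z * w) = nrm z * nrm w.
Proof. exact: Normc.normcM. Qed.

Lemma nrmV (z : C) : nrm z^-1 = (nrm z)^-1.
Proof. exact: Normc.normcV. Qed.

Lemma nrmN (z : C) : nrm (- z) = nrm z.
Proof. exact: normcN. Qed.

Lemma nrmD (z w : C) : nrm (z + w) <= nrm z + nrm w.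
Proof. exact: le_normcD. Qed.

Lemma nrmB (z w : C) : nrm (z - w) = nrm (w - z).
Proof. by rewrite -nrmN opprB. Qed.

Lemma nrmBD (z w : C) : nrm (z - w) <= nrm z + nrm w.
Proof. by rewrite -(nrmN w) nrmD. Qed.

Lemma nrmX (z : C) k : nrm (z ^+ k) = nrm z ^+ k.
Proof.
elim: k => [|k IH]; first exact: Normc.normc1.
by rewrite !exprS nrmM IH.
Qed.

Lemma nrm_tri (x y z : C) : nrm (x - z) <= nrm (x - y) + nrm (y - z).
Proof. by rewrite (le_trans _ (nrmD _ _))// addrA subrK. Qed.

Lemma nrm_real (x : R) : nrm (x%:C : R[i]) = `|x|.
Proof. by rewrite /nrm /= expr0n addr0 sqrtr_sqr. Qed.

Lemma le_Re_nrm (z : C) : `|complex.Re (z : R[i])| <= nrm z.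
Proof.
have := normc_ge_Re z.
by rewrite (normE z) lecR.
Qed.

Lemma le_Im_nrm (z : C) : `|ImC z| <= nrm z.
Proof.
case: z => a b; rewrite /nrm /ImC /= -sqrtr_sqr ler_wsqrtr// lerDr sqr_ge0 //.
Qed.

Lemma nrm_le_ReIm (z : C) : nrm z <= `|complex.Re (z : R[i])| + `|ImC z|.
Proof.
case: z => a b; rewrite /nrm /ImC /=.
have h : a ^+ 2 + b ^+ 2 <= (`|a| + `|b|) ^+ 2.
  by rewrite sqrrD !real_normK ?num_real// addrAC lerDl mulrn_wge0// mulr_ge0.
by rewrite (le_trans (ler_wsqrtr h))// sqrtr_sqr ger0_norm// addr_ge0.
Qed.

Lemma normc_lt (z : C) (e : R) : (`|z| < (e%:C : R[i])) = (nrm z < e).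
Proof. by rewrite normE ltcR. Qed.

(** A positive element for the order of [R[i]] has zero imaginary part, so every complex radius can
    be traded for a real one. *)
Lemma posC (e : C) : 0 < e -> exists2 r : R, 0 < r & e = (r%:C : R[i]).
Proof.
case: e => a b; rewrite ltcE /= => /andP[/eqP -> a0]; exists a => //.
Qed.

Lemma nbhsCP (z : C) (U : set C) :
  nbhs z U <-> exists2 e : R, 0 < e & forall w, nrm (w - z) < e -> U w.
Proof.
split.
  move=> /nbhs_ballP[e /= /posC[r r0 ->] Ur]; exists r => // w wz.
  by apply: Ur; rewrite -ball_normE /= distrC normc_lt.
move=> [e e0 Ue]; apply/nbhs_ballP; exists ((e%:C) : R[i]); first by rewrite /= ltcR.
move=> w; rewrite -ball_normE /= distrC normc_lt; exact: Ue.
Qed.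

Lemma cvgCP (T : Type) (F : set_system T) (FF : Filter F) (f : T -> C) (l : C) :
  f @ F --> l <-> forall e : R, 0 < e -> \forall x \near F, nrm (f x - l) < e.
Proof.
split.
  move=> /cvgrPdist_lt H e e0.
  have /H : 0 < ((e%:C : R[i]) : C) by rewrite ltcR.
  by apply: filterS => x; rewrite distrC normc_lt.
move=> H; apply/cvgrPdist_lt => e /posC[r r0 ->].
by apply: filterS (H _ r0) => x; rewrite distrC normc_lt.
Qed.

Lemma continuousCP (f : C -> C) (z : C) :
  {for z, continuous f} <-> forall e : R, 0 < e -> exists2 d : R, 0 < d &
     forall w, nrm (w - z) < d -> nrm (f w - f z) < e.
Proof.
have key := @cvgCP C (nbhs z) _ f (f z).
split.
  by move=> /key H e e0; have /nbhsCP[d d0 Hd] := H _ e0; exists d.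
by move=> H; apply/key => e e0; apply/nbhsCP; exact: H.
Qed.

(** Multiplying the difference quotient by w - a removes the puncture: at w = a the bound reads 0 <=
    0. *)
Lemma is_derive_eps (f : C -> C) (a l : C) :
  is_derive a 1 f l <-> forall e : R, 0 < e -> exists2 d : R, 0 < d &
   forall w, nrm (w - a) < d -> nrm (f w - f a - l * (w - a)) <= e * nrm (w - a).
Proof.
have key : (fun h : C => h^-1 *: (f (h *: 1 + a) - f a)) @ 0^' --> l <->
   forall e : R, 0 < e -> exists2 d : R, 0 < d &
   forall w, nrm (w - a) < d -> nrm (f w - f a - l * (w - a)) <= e * nrm (w - a).
  have key0 := @cvgCP C (0^') _ (fun h : C => h^-1 *: (f (h *: 1 + a) - f a)) l.
  split.
    move=> /key0 H e e0; 
    have H1 : nbhs (0 : C) (fun h : C => h != 0 ->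
      nrm (h^-1 *: (f (h *: 1 + a) - f a) - l) < e) := H _ e0.
    move: H1 => /nbhsCP[d d0 Hd]; exists d => // w wd.
    have [->|wa] := eqVneq w a; first by rewrite !subrr mulr0 subr0 nrm0 mulr0.
    have wa' : w - a != 0 by rewrite subr_eq0.
    have := Hd (w - a); rewrite subr0 => /(_ wd wa').
    rewrite [_ *: 1]mulr1 subrK.
    rewrite [_ *: _]mulrC => h.
    rewrite -[X in nrm X](@mulfVK _ (w - a))// nrmM ler_wpM2r ?nrm_ge0//.
    by rewrite mulrBl mulfK// ltW.
  move=> H; apply/key0 => e e0; 
  (* Halving e turns the non-strict bound into the strict one required by the limit. *)
  have e20 : 0 < e / 2 by rewrite divr_gt0.
  have [d d0 Hd] := H _ e20.
  suff: nbhs (0 : C) (fun h : C => h != 0 ->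
    nrm (h^-1 *: (f (h *: 1 + a) - f a) - l) < e) by [].
  apply/nbhsCP; exists d => // h hd h0.
  have := Hd (h + a); rewrite addrK -[h in nrm h < _]subr0 => /(_ hd).
  have nh : 0 < nrm h by rewrite nrm_gt0.
  rewrite [h *: 1]mulr1 [_ *: _]mulrC => hh.
  rewrite -[X in nrm X](@mulfK _ h)// nrmM nrmV ltr_pdivrMr//.
  rewrite mulrBl mulfVK//; apply: le_lt_trans hh _.
  by rewrite ltr_pM2r// ltr_pdivrMr// ltr_pMr// ltr1n.
split.
  by move=> [H1 H2]; apply/key; rewrite -H2; exact: H1.
move=> /key H; split; first by apply/cvg_ex; exists l.
exact: cvg_lim H.
Qed.

Lemma derive1_val (f : C -> C) (a l : C) : is_derive a 1 f l -> derive1 f a = l.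
Proof. by move=> H; rewrite derive1E derive_val. Qed.

Lemma derivable_is_derive1 (f : C -> C) (a : C) :
  derivable f a 1 -> is_derive a 1 f (derive1 f a).
Proof. by move=> H; rewrite derive1E; apply: derivableP. Qed.

Lemma is_derive_derivable (f : C -> C) (a l : C) : is_derive a 1 f l -> derivable f a 1.
Proof. by move=> []. Qed.

Lemma derivable_continuous_at (f : C -> C) (a : C) :
  derivable f a 1 -> {for a, continuous f}.
Proof. by move=> /derivable1_diffP/differentiable_continuous. Qed.

Lemma is_derive_chain (f g : C -> C) (a df dg : C) :
  is_derive (g a) 1 f df -> is_derive a 1 g dg -> is_derive a 1 (f \o g) (df * dg).
Proof.
move=> /is_derive_eps Hf /is_derive_eps Hg; apply/is_derive_eps => e e0.
(* K is a Lipschitz constant of g at a, obtained below from error 1 in the derivative of g; the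
   added 1 also keeps K and L nonzero as divisors. *)
set K := nrm dg + 1; set L := nrm df + 1.
have K0 : 0 < K by rewrite ltr_wpDl ?nrm_ge0.
have L0 : 0 < L by rewrite ltr_wpDl ?nrm_ge0.
have [d1 d10 H1] := Hf (e / 2 / K) (divr_gt0 (divr_gt0 e0 (ltr0Sn _ 1)) K0).
have [d2 d20 H2] := Hg (e / 2 / L) (divr_gt0 (divr_gt0 e0 (ltr0Sn _ 1)) L0).
have [d3 d30 H3] := Hg 1 ltr01.
exists (Num.min d2 (Num.min d3 (d1 / K))); first by rewrite !lt_min d20 d30 divr_gt0.
move=> w; rewrite !lt_min => /and3P[w2 w3 w1] /=.
have gw : nrm (g w - g a) <= K * nrm (w - a).
  rewrite -[g w - g a](subrK (dg * (w - a))) (le_trans (nrmD _ _))// nrmM.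
  by rewrite /K mulrDl addrC lerD2l; exact: H3.
have gw1 : nrm (g w - g a) < d1.
  by apply: le_lt_trans gw _; rewrite mulrC -ltr_pdivlMr.
have -> : f (g w) - f (g a) - df * dg * (w - a) =
  (f (g w) - f (g a) - df * (g w - g a)) + df * (g w - g a - dg * (w - a)) by ring.
apply: le_trans (nrmD _ _) _; rewrite nrmM.
have -> : e * nrm (w - a) = e / 2 * nrm (w - a) + e / 2 * nrm (w - a) by lra.
apply: lerD.
  apply: le_trans (H1 _ gw1) _.
  have -> : e / 2 * nrm (w - a) = e / 2 / K * (K * nrm (w - a)).
    by rewrite mulrA divfK ?gt_eqF.
  by rewrite ler_wpM2l// divr_ge0 ?(ltW K0)// divr_ge0// ltW.
apply: (@le_trans _ _ (L * (e / 2 / L * nrm (w - a)))); last first.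
  by rewrite mulrA [L * _]mulrC divfK ?gt_eqF.
apply: ler_pM; rewrite ?nrm_ge0//; last exact: H2.
by rewrite lerDl.
Qed.

(** The conclusion is again an equality near a, so the lemma can be iterated up to the third
    derivative. *)
Lemma near_eq_derive1 (f g : C -> C) (a : C) :
  (\near a, f a = g a) -> \near a, derive1 f a = derive1 g a.
Proof.
move=> /near_join; apply: filterS => w H.
by rewrite !derive1E; apply: near_eq_derive => //; rewrite oner_neq0.
Qed.

Lemma near_eq_is_derive1 (f g : C -> C) (a l : C) :
  (\near a, f a = g a) -> is_derive a 1 f l -> is_derive a 1 g l.
Proof.
by move=> H; apply: near_eq_is_derive => //; rewrite oner_neq0.
Qed.

Lemma is_derive_inv (f : C -> C) (a df : C) : f a != 0 ->
  is_derive a 1 f df -> is_derive a 1 (fun z => (f z)^-1) (- df / f a ^+ 2).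
Proof.
move=> f0 [Df Ef]; split; first exact: derivableV.
by rewrite deriveV// Ef [_ *: _]mulrC mulNr mulrN.
Qed.

Lemma is_derive_prod (f g : C -> C) (a df dg : C) :
  is_derive a 1 f df -> is_derive a 1 g dg ->
  is_derive a 1 (fun z => f z * g z) (df * g a + f a * dg).
Proof.
move=> Hf Hg; have := @is_deriveM _ _ f g a 1 df dg Hf Hg.
by rewrite addrC; congr is_derive; rewrite /GRing.scale /= mulrC.
Qed.

(** A quadratic remainder is what an integrated Taylor estimate yields; with it, differentiation
    under the integral sign needs no limit theorem for integrals. *)
Lemma is_derive_sq_bound (f : C -> C) (a l : C) (M d : R) : 0 < d ->
  (forall w, nrm (w - a) < d -> nrm (f w - f a - l * (w - a)) <= M * nrm (w - a) ^+ 2) ->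
  is_derive a 1 f l.
Proof.
move=> d0 H; apply/is_derive_eps => e e0.
have M0 : 0 < `|M| + 1 by rewrite ltr_wpDl.
exists (Num.min d (e / (`|M| + 1))); first by rewrite lt_min d0 divr_gt0.
move=> w; rewrite lt_min => /andP[wd we]; apply: le_trans (H _ wd) _.
rewrite expr2 mulrA ler_wpM2r ?nrm_ge0//.
rewrite ltr_pdivlMr// in we.
apply: le_trans (ltW we); rewrite mulrC ler_wpM2l ?nrm_ge0//.
by rewrite (le_trans (ler_norm _))// lerDl.
Qed.

End ComplexNorm.

(** * Integrals of complex functions over real segments *)

Section RealIntegral.
Variable R : realType.
Implicit Types (u v : R -> R) (a b c : R).

Definition rint u a b : R := \int[@lebesgue_measure R]_(x in `[a, b]) u x.

(** Continuity is two-sided even at the end points. The integrands are restrictions to a line of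
    functions continuous in the plane at each point of the segment, so they satisfy it. *)
Definition cts_on u a b := forall x, a <= x <= b -> {for x, continuous u}.

Lemma cts_on_within u a b : cts_on u a b -> {within `[a, b], continuous u}.
Proof.
move=> H; apply/continuous_in_subspaceT => x; rewrite inE /= in_itv /= => xab.
exact: H.
Qed.

Lemma cts_on_integrable u a b : cts_on u a b ->
  (@lebesgue_measure R).-integrable `[a, b] (EFin \o u).
Proof.
move=> /cts_on_within H; apply: continuous_compact_integrable => //.
exact: segment_compact.
Qed.

Lemma rintD u v a b : cts_on u a b -> cts_on v a b ->
  rint (fun x => u x + v x) a b = rint u a b + rint v a b.
Proof. by move=> uc vc; rewrite /rint RintegralD//; apply: cts_on_integrable. Qed.

Lemma rintB u v a b : cts_on u a b -> cts_on v a b ->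
  rint (fun x => u x - v x) a b = rint u a b - rint v a b.
Proof. by move=> uc vc; rewrite /rint RintegralB//; apply: cts_on_integrable. Qed.

Lemma rintZ k u a b : cts_on u a b ->
  rint (fun x => k * u x) a b = k * rint u a b.
Proof. by move=> uc; rewrite /rint RintegralZl//; apply: cts_on_integrable. Qed.

Lemma rint_cst k a b : a <= b -> rint (fun _ => k) a b = k * (b - a).
Proof.
move=> ab; rewrite /rint Rintegral_cst//; congr (_ * _).
rewrite -[X in fine X]/(lebesgue_measure `[a, b]) lebesgue_measure_itv /= lte_fin; move: ab; rewrite le_eqVlt.
case/orP => [/eqP ->|->]; last by [].
by rewrite ltxx subrr.
Qed.

Lemma rint_cat u a b c : a <= b -> b <= c -> cts_on u a c ->
  rint u a c = rint u a b + rint u b c.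
Proof.
move=> ab bc uc; apply/eqP; rewrite addrC -subr_eq; apply/eqP.
rewrite /rint Rintegral_itvB//; [|exact: cts_on_integrable|by rewrite bnd_simp..].
rewrite Rintegral_itv_obnd_cbnd//.
apply: integrableS (cts_on_integrable uc) => //.
by apply: subset_itvr; rewrite bnd_simp.
Qed.

Lemma le_rint u v a b : cts_on u a b -> cts_on v a b ->
  (forall x, a <= x <= b -> u x <= v x) -> rint u a b <= rint v a b.
Proof.
move=> uc vc H; apply: le_Rintegral (cts_on_integrable uc) (cts_on_integrable vc) _ => //.
Qed.

Lemma eq_rint u v a b : (forall x, a <= x <= b -> u x = v x) ->
  rint u a b = rint v a b.
Proof.
move=> H; apply: eq_Rintegral => x; rewrite inE /= in_itv; exact: H.
Qed.

Lemma cts_on_cst k a b : cts_on (fun _ => k) a b.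
Proof. by move=> x _; exact: cvg_cst. Qed.

Lemma rint_bound u a b M : a <= b -> cts_on u a b ->
  (forall x, a <= x <= b -> `|u x| <= M) -> `|rint u a b| <= M * (b - a).
Proof.
move=> ab uc H; rewrite ler_norml; apply/andP; split.
  rewrite -mulNr -rint_cst//; apply: le_rint => //; first exact: cts_on_cst.
  by move=> x /H; rewrite ler_norml => /andP[].
rewrite -rint_cst//; apply: le_rint => //; first exact: cts_on_cst.
by move=> x /H; rewrite ler_norml => /andP[].
Qed.

(** The minimum over the segment is attained, hence positive, and its product with the length bounds
    the integral from below. *)
Lemma rint_gt0 u a b : a < b -> cts_on u a b ->
  (forall x, a <= x <= b -> 0 < u x) -> 0 < rint u a b.
Proof.
move=> ab uc H.
have [c cab Hc] := EVT_min (ltW ab) (cts_on_within uc).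
have c0 : 0 < u c by apply: H; rewrite in_itv /= in cab.
apply: (@lt_le_trans _ _ (u c * (b - a))); first by rewrite mulr_gt0// subr_gt0.
rewrite -rint_cst ?(ltW ab)//; apply: le_rint => //; first exact: cts_on_cst.

Qed.

End RealIntegral.

(** * Complex-valued integrands, through their real and imaginary parts *)

Section ComplexIntegral.
Variable R : realType.
Local Open Scope complex_scope.
Local Notation C := (Cplx R).
Implicit Types (g h : R -> C) (a b c : R).

Definition ReC (z : C) : R := complex.Re (z : R[i]).
Definition mkC (x y : R) : C := (x +i* y : R[i]).

Lemma ReCD (z w : C) : ReC (z + w) = ReC z + ReC w.
Proof. by case: z; case: w. Qed.
Lemma ImCD (z w : C) : ImC (z + w) = ImC z + ImC w.
Proof. by case: z; case: w. Qed.
Lemma ReCN (z : C) : ReC (- z) = - ReC z.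
Proof. by case: z. Qed.
Lemma ImCN (z : C) : ImC (- z) = - ImC z.
Proof. by case: z. Qed.
Lemma ReCM (z w : C) : ReC (z * w) = ReC z * ReC w - ImC z * ImC w.
Proof. by case: z; case: w. Qed.
Lemma ImCM (z w : C) : ImC (z * w) = ReC z * ImC w + ImC z * ReC w.
Proof. by case: z; case: w. Qed.

Lemma C_eq (z w : C) : ReC z = ReC w -> ImC z = ImC w -> z = w.
Proof. by case: z => a b; case: w => c d /= ; rewrite /ReC /ImC /= => -> ->. Qed.

Lemma mkCE (z : C) : z = mkC (ReC z) (ImC z).
Proof. by case: z. Qed.

Definition ccts_on g a b := forall x, a <= x <= b -> {for x, continuous g}.

Lemma cvg_ReIm (T : Type) (F : set_system T) (FF : Filter F) (f : T -> C) (l : C) :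
  f @ F --> l -> (fun x => ReC (f x)) @ F --> ReC l /\
    (fun x => ImC (f x)) @ F --> ImC l.
Proof.
move=> /cvgCP H; split; apply/cvgrPdist_lt => e e0; have := H _ e0.
  apply: filterS => x; rewrite distrC; apply: le_lt_trans.
  by rewrite -ReCN -ReCD le_Re_nrm.
apply: filterS => x; rewrite distrC; apply: le_lt_trans.
by rewrite -ImCN -ImCD le_Im_nrm.
Qed.

Lemma ccts_on_Re g a b : ccts_on g a b -> cts_on (fun x => ReC (g x)) a b.
Proof. by move=> H x xab; have [] := @cvg_ReIm _ (nbhs x) _ _ _ (H _ xab). Qed.

Lemma ccts_on_Im g a b : ccts_on g a b -> cts_on (fun x => ImC (g x)) a b.
Proof. by move=> H x xab; have [] := @cvg_ReIm _ (nbhs x) _ _ _ (H _ xab). Qed.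

Definition cint g a b : C :=
  mkC (rint (fun x => ReC (g x)) a b) (rint (fun x => ImC (g x)) a b).

Lemma eq_cint g h a b : (forall x, a <= x <= b -> g x = h x) -> cint g a b = cint h a b.
Proof. by move=> H; congr mkC; apply: eq_rint => x /H ->. Qed.

Lemma cintD g h a b : ccts_on g a b -> ccts_on h a b ->
  cint (fun x => g x + h x) a b = cint g a b + cint h a b.
Proof.
move=> gc hc; apply: C_eq; rewrite ?ReCD ?ImCD /ReC /ImC /= -rintD;
  try (exact: ccts_on_Re || exact: ccts_on_Im); by apply: eq_rint => x _; rewrite -?ReCD -?ImCD.
Qed.

Lemma cts_onZ k (u : R -> R) a b : cts_on u a b -> cts_on (fun x => k * u x) a b.
Proof. by move=> H x /H; apply: cvgM; exact: cvg_cst. Qed.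

Lemma cintZ k g a b : ccts_on g a b ->
  cint (fun x => k * g x) a b = k * cint g a b.
Proof.
move=> gc; have gr := ccts_on_Re gc; have gi := ccts_on_Im gc.
apply: C_eq; rewrite ?ReCM ?ImCM /= -!rintZ//.
  rewrite -rintB; try exact: cts_onZ.
  by apply: eq_rint => x _; rewrite -ReCM.
rewrite -rintD; try exact: cts_onZ.
by apply: eq_rint => x _; rewrite -ImCM.
Qed.

Lemma cint_cst k a b : a <= b -> cint (fun _ => k) a b = k * mkC (b - a) 0.
Proof.
move=> ab; rewrite /cint !rint_cst//; apply: C_eq.
  by rewrite ReCM /ReC /ImC /= mulr0 subr0.
by rewrite ImCM /ReC /ImC /= mulr0 add0r.
Qed.

Lemma cint_cat g a b c : a <= b -> b <= c -> ccts_on g a c ->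
  cint g a c = cint g a b + cint g b c.
Proof.
move=> ab bc gc; rewrite /cint (@rint_cat _ _ a b c)//; last exact: ccts_on_Re.
by rewrite [X in mkC _ X](@rint_cat _ _ a b c)//; exact: ccts_on_Im.
Qed.

(** The factor 2 comes from bounding the real and imaginary parts separately; no estimate below
    needs the sharp constant. *)
Lemma cint_bound g a b M : a <= b -> ccts_on g a b ->
  (forall x, a <= x <= b -> nrm (g x) <= M) -> nrm (cint g a b) <= 2 * M * (b - a).
Proof.
move=> ab gc H; rewrite (le_trans (nrm_le_ReIm _))// -mulrA mulr2n mulrDl !mul1r.
apply: lerD; apply: rint_bound => //; try (exact: ccts_on_Re || exact: ccts_on_Im).
  by move=> x /H; apply: le_trans; exact: le_Re_nrm.
by move=> x /H; apply: le_trans; exact: le_Im_nrm.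
Qed.

End ComplexIntegral.

(** * Boundary integrals of rectangles *)

Section RectangleIntegral.
Variable R : realType.
Local Open Scope complex_scope.
Local Notation C := (Cplx R).
Implicit Types (F G : C -> C).

(** The counterclockwise contour integral of F(z) dz: dz is dx on the horizontal sides and i dy on
    the vertical ones, and the minus signs reverse the top and left sides. *)
Definition bdint F x0 x1 y0 y1 : C :=
  cint (fun x => F (mkC x y0)) x0 x1 - cint (fun x => F (mkC x y1)) x0 x1
  + mkC 0 1 * (cint (fun y => F (mkC x1 y)) y0 y1 - cint (fun y => F (mkC x0 y)) y0 y1).

Definition on_edge x0 x1 y0 y1 (z : C) : Prop :=
  (x0 <= ReC z <= x1 /\ (ImC z = y0 \/ ImC z = y1)) \/
  (y0 <= ImC z <= y1 /\ (ReC z = x0 \/ ReC z = x1)).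

Definition edge_cts F x0 x1 y0 y1 :=
  forall z, on_edge x0 x1 y0 y1 z -> {for z, continuous F}.

Lemma cts_comp_mkC F (h : R -> C) (x : R) :
  {for h x, continuous F} -> (forall y, nrm (h y - h x) <= `|y - x|) ->
  {for x, continuous (fun y => F (h y))}.
Proof.
move=> Fc hl; apply: (@continuous_comp _ _ _ h F); last exact: Fc.
apply/(@cvgCP _ _ (nbhs x)) => e e0; apply/nbhs_ballP; exists e => // y.
rewrite /ball /= distrC => yx; exact: le_lt_trans (hl y) yx.
Qed.

Lemma mkC_lipx (y x x' : R) : nrm (mkC x' y - mkC x y) <= `|x' - x|.
Proof.
rewrite (le_trans (nrm_le_ReIm _))// -/(ReC _) ReCD ImCD ReCN ImCN /ReC /ImC /=.
by rewrite subrr normr0 addr0.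
Qed.

Lemma mkC_lipy (x y y' : R) : nrm (mkC x y' - mkC x y) <= `|y' - y|.
Proof.
rewrite (le_trans (nrm_le_ReIm _))// -/(ReC _) ReCD ImCD ReCN ImCN /ReC /ImC /=.
by rewrite subrr normr0 add0r.
Qed.

Lemma ccts_onx F x0 x1 y : (forall x, x0 <= x <= x1 -> {for mkC x y, continuous F}) ->
  ccts_on (fun x => F (mkC x y)) x0 x1.
Proof.
move=> H x /H Fc; apply: (@cts_comp_mkC F (fun x => mkC x y)) => // x'.
exact: mkC_lipx.
Qed.

Lemma ccts_ony F y0 y1 x : (forall y, y0 <= y <= y1 -> {for mkC x y, continuous F}) ->
  ccts_on (fun y => F (mkC x y)) y0 y1.
Proof.
move=> H y /H Fc; apply: (@cts_comp_mkC F (fun y => mkC x y)) => // y'.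
exact: mkC_lipy.
Qed.

Lemma edge_cts_sides F x0 x1 y0 y1 : edge_cts F x0 x1 y0 y1 ->
  [/\ ccts_on (fun x => F (mkC x y0)) x0 x1, ccts_on (fun x => F (mkC x y1)) x0 x1,
    ccts_on (fun y => F (mkC x1 y)) y0 y1 & ccts_on (fun y => F (mkC x0 y)) y0 y1].
Proof.
move=> H; split; [apply: ccts_onx|apply: ccts_onx|apply: ccts_ony|apply: ccts_ony];
  move=> s sP; apply: H; rewrite /on_edge /ReC /ImC /=; intuition.
Qed.

Lemma eq_bdint F G x0 x1 y0 y1 :
  (forall z, on_edge x0 x1 y0 y1 z -> F z = G z) ->
  bdint F x0 x1 y0 y1 = bdint G x0 x1 y0 y1.
Proof.
move=> H; rewrite /bdint; congr (_ - _ + _ * (_ - _)); apply: eq_cint => s sP;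
  apply: H; rewrite /on_edge /ReC /ImC /=; intuition.
Qed.

Lemma bdintD F G x0 x1 y0 y1 : edge_cts F x0 x1 y0 y1 -> edge_cts G x0 x1 y0 y1 ->
  bdint (fun z => F z + G z) x0 x1 y0 y1 = bdint F x0 x1 y0 y1 + bdint G x0 x1 y0 y1.
Proof.
move=> /edge_cts_sides[? ? ? ?] /edge_cts_sides[? ? ? ?].
by rewrite /bdint !cintD//; ring.
Qed.

Lemma bdintZ k F x0 x1 y0 y1 : edge_cts F x0 x1 y0 y1 ->
  bdint (fun z => k * F z) x0 x1 y0 y1 = k * bdint F x0 x1 y0 y1.
Proof.
move=> /edge_cts_sides[? ? ? ?].
by rewrite /bdint !cintZ//; ring.
Qed.

(** The constant 4 is the factor 2 of [cint_bound] times the two sides in each direction. *)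
Lemma bdint_bound F x0 x1 y0 y1 M : x0 <= x1 -> y0 <= y1 -> edge_cts F x0 x1 y0 y1 ->
  (forall z, on_edge x0 x1 y0 y1 z -> nrm (F z) <= M) ->
  nrm (bdint F x0 x1 y0 y1) <= 4 * M * ((x1 - x0) + (y1 - y0)).
Proof.
move=> x01 y01 /edge_cts_sides[c1 c2 c3 c4] H.
have b1 : nrm (cint (fun x => F (mkC x y0)) x0 x1) <= 2 * M * (x1 - x0).
  by apply: cint_bound => // s sP; apply: H; rewrite /on_edge /ReC /ImC /=; intuition.
have b2 : nrm (cint (fun x => F (mkC x y1)) x0 x1) <= 2 * M * (x1 - x0).
  by apply: cint_bound => // s sP; apply: H; rewrite /on_edge /ReC /ImC /=; intuition.
have b3 : nrm (cint (fun y => F (mkC x1 y)) y0 y1) <= 2 * M * (y1 - y0).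
  by apply: cint_bound => // s sP; apply: H; rewrite /on_edge /ReC /ImC /=; intuition.
have b4 : nrm (cint (fun y => F (mkC x0 y)) y0 y1) <= 2 * M * (y1 - y0).
  by apply: cint_bound => // s sP; apply: H; rewrite /on_edge /ReC /ImC /=; intuition.
rewrite /bdint (le_trans (nrmD _ _))// nrmM.
have -> : nrm (mkC 0 1 : C) = 1.
  by rewrite /nrm /= expr0n add0r expr1n sqrtr1.
have c12 := nrmBD (cint (fun x => F (mkC x y0)) x0 x1) (cint (fun x => F (mkC x y1)) x0 x1).
have c34 := nrmBD (cint (fun y => F (mkC x1 y)) y0 y1) (cint (fun y => F (mkC x0 y)) y0 y1).
lra.
Qed.

(** The common vertical side is traversed once in each direction and cancels, while the horizontal
    sides add up. *)
Lemma bdint_catx F x0 m x1 y0 y1 : x0 <= m <= x1 -> edge_cts F x0 x1 y0 y1 ->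
  bdint F x0 x1 y0 y1 = bdint F x0 m y0 y1 + bdint F m x1 y0 y1.
Proof.
move=> /andP[x0m mx1] /edge_cts_sides[c1 c2 c3 c4].
by rewrite /bdint (cint_cat x0m mx1 c1) (cint_cat x0m mx1 c2); ring.
Qed.

Lemma bdint_caty F x0 x1 y0 m y1 : y0 <= m <= y1 -> edge_cts F x0 x1 y0 y1 ->
  bdint F x0 x1 y0 y1 = bdint F x0 x1 y0 m + bdint F x0 x1 m y1.
Proof.
move=> /andP[y0m my1] /edge_cts_sides[c1 c2 c3 c4].
by rewrite /bdint (cint_cat y0m my1 c3) (cint_cat y0m my1 c4); ring.
Qed.

Lemma cts_affine (p q : C) (z : C) : {for z, continuous (fun z => p + q * z)}.
Proof.
apply: (@cvgD _ _ _ (nbhs z)); first exact: cvg_cst.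
by apply: (@cvgM _ _ (nbhs z)); [exact: cvg_cst|exact: cvg_id].
Qed.

Lemma bdint_affine (p q : C) x0 x1 y0 y1 : x0 <= x1 -> y0 <= y1 ->
  bdint (fun z => p + q * z) x0 x1 y0 y1 = 0.
Proof.
move=> x01 y01.
have /edge_cts_sides[c1 c2 c3 c4] : edge_cts (fun z => p + q * z) x0 x1 y0 y1.
  by move=> z _; exact: cts_affine.
have shift (g h : R -> C) (k : C) a b : a <= b -> ccts_on h a b ->
    (forall x, g x = k + h x) -> cint g a b = k * mkC (b - a) 0 + cint h a b.
  move=> ab hc gh; rewrite (@eq_cint _ g (fun x => k + h x))//.
  have kc : ccts_on (fun=> k) a b by move=> x _; exact: cvg_cst.
  by apply: etrans (cintD kc hc) _; rewrite (cint_cst k ab).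
have e1 := shift (fun x => p + q * mkC x y0) (fun x => p + q * mkC x y1)
  (q * mkC 0 (y0 - y1)) x0 x1 x01 c2.
have e2 := shift (fun y => p + q * mkC x1 y) (fun y => p + q * mkC x0 y)
  (q * mkC (x1 - x0) 0) y0 y1 y01 c4.
rewrite /bdint e1 ?e2; last 2 first.
- move=> x; have E : mkC x1 x = mkC (x1 - x0) 0 + mkC x0 x.
    by apply: C_eq; rewrite ?ReCD ?ImCD /ReC /ImC /= ?add0r ?subrK.
  by rewrite E mulrDr addrCA.
- move=> x; have E : mkC x y0 = mkC 0 (y0 - y1) + mkC x y1.
    by apply: C_eq; rewrite ?ReCD ?ImCD /ReC /ImC /= ?add0r ?subrK.
  by rewrite E mulrDr addrCA.
have E : mkC 0 (y0 - y1) = - (mkC 0 1 * mkC (y1 - y0) 0) :> C.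
  by apply: C_eq; rewrite ?ReCN ?ImCN ?ReCM ?ImCM /ReC /ImC /=; ring.
rewrite E !addrK.
by ring.
Qed.

End RectangleIntegral.

(** * Nested intervals and repeated quartering of a rectangle *)

Section Bisection.
Variable R : realType.

(** The left ends increase and each right end bounds all of them, so their supremum lies in every
    interval. *)
Lemma nested_limit (x : nat -> R) (w : R) : 0 <= w ->
  (forall n, x n <= x n.+1 /\ x n.+1 + w / 2 ^+ n.+1 <= x n + w / 2 ^+ n) ->
  exists c, forall n, x n <= c <= x n + w / 2 ^+ n.
Proof.
move=> w0 H.
have inc m k : x m <= x (m + k)%N.
  elim: k => [|k IH]; first by rewrite addn0.
  by rewrite addnS (le_trans IH)//; case: (H (m + k)%N).
have dec m k : x (m + k)%N + w / 2 ^+ (m + k) <= x m + w / 2 ^+ m.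
  elim: k => [|k IH]; first by rewrite addn0.
  by rewrite addnS (le_trans _ IH)//; case: (H (m + k)%N).
have wn n : 0 <= w / 2 ^+ n by rewrite divr_ge0// exprn_ge0.
have ub m n : x m <= x n + w / 2 ^+ n.
  have [mn|nm] := leqP m n.
    by rewrite -(subnKC mn) (le_trans (inc m (n - m)%N))// lerDl.
  by apply: le_trans (dec n (m - n)%N); rewrite (subnKC (ltnW nm)) lerDl.
have hs : has_sup (range x).
  split; first by exists (x 0%N), 0%N.
  by exists (x 0%N + w / 2 ^+ 0) => _ [n _ <-]; exact: ub.
exists (sup (range x)) => n; apply/andP; split.
  by apply: ub_le_sup; [case: hs|exists n].
by apply: ge_sup; [case: hs|move=> _ [m _ <-]; exact: ub].
Qed.

(** [P n x y] is a property of the box with lower left corner (x, y) and sides w / 2^n and h / 2^n;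
    each step passes to one of its four quarters. *)
Lemma bisection (P : nat -> R -> R -> Prop) (w h a b : R) : 0 <= w -> 0 <= h ->
  P 0%N a b ->
  (forall n x y, P n x y -> exists x' y',
     [/\ x' = x \/ x' = x + w / 2 ^+ n.+1, y' = y \/ y' = y + h / 2 ^+ n.+1 &
      P n.+1 x' y']) ->
  exists cx cy, forall n, exists x y,
    [/\ x <= cx <= x + w / 2 ^+ n, y <= cy <= y + h / 2 ^+ n & P n x y].
Proof.
move=> w0 h0 P0 step.
(* Choice needs a successor for every state; where [P] fails the requirement is vacuous and (0, 0)
   serves. *)
have /choice[f fP] : forall s : nat * (R * R), exists s' : R * R,
    P s.1 s.2.1 s.2.2 -> [/\ s'.1 = s.2.1 \/ s'.1 = s.2.1 + w / 2 ^+ s.1.+1,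
      s'.2 = s.2.2 \/ s'.2 = s.2.2 + h / 2 ^+ s.1.+1 & P s.1.+1 s'.1 s'.2].
  move=> [n [x y]] /=; have [Pn|nP] := pselect (P n x y).
    by have [x' [y' ?]] := step _ _ _ Pn; exists (x', y').
  by exists (0, 0).
pose s := fix s n := if n is m.+1 then f (m, s m) else (a, b).
have Ps n : P n (s n).1 (s n).2.
  by elim: n => [//|n IH]; have [_ _] := fP (n, s n) IH.
have half (v : R) n : v / 2 ^+ n = v / 2 ^+ n.+1 + v / 2 ^+ n.+1.
  by rewrite exprS; field; rewrite expf_neq0.
have [cx cxP] : exists c, forall n, (s n).1 <= c <= (s n).1 + w / 2 ^+ n.
  apply: nested_limit => // n.
  have wn : 0 <= w / 2 ^+ n.+1 by rewrite divr_ge0// exprn_ge0.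
  have := half w n; have [[->|->] _ _] := fP (n, s n) (Ps n) => /= E; lra.
have [cy cyP] : exists c, forall n, (s n).2 <= c <= (s n).2 + h / 2 ^+ n.
  apply: nested_limit => // n.
  have wn : 0 <= h / 2 ^+ n.+1 by rewrite divr_ge0// exprn_ge0.
  have := half h n; have [_ [->|->] _] := fP (n, s n) (Ps n) => /= E; lra.
by exists cx, cy => n; exists (s n).1, (s n).2.
Qed.

End Bisection.

(** * Goursat's lemma and Cauchy's formula *)

Section Goursat.
Variable R : realType.
Local Open Scope complex_scope.
Local Notation C := (Cplx R).
Implicit Types (F G : C -> C).

Definition in_rect (x0 x1 y0 y1 : R) (z : C) : Prop :=
  x0 <= ReC z <= x1 /\ y0 <= ImC z <= y1.

Lemma on_edge_in_rect x0 x1 y0 y1 z : x0 <= x1 -> y0 <= y1 ->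
  on_edge x0 x1 y0 y1 z -> in_rect x0 x1 y0 y1 z.
Proof.
move=> x01 y01 [[zx [zy|zy]]|[zy [zx|zx]]]; split => //; apply/andP; split; lra.
Qed.

Lemma edge_cts_sub F x0 x1 y0 y1 u0 u1 v0 v1 :
  (forall z, in_rect x0 x1 y0 y1 z -> {for z, continuous F}) ->
  x0 <= u0 -> u0 <= u1 -> u1 <= x1 -> y0 <= v0 -> v0 <= v1 -> v1 <= y1 ->
  edge_cts F u0 u1 v0 v1.
Proof.
move=> H h1 h2 h3 h4 h5 h6 z /(on_edge_in_rect h2 h5)[/andP[? ?] /andP[? ?]].
by apply: H; split; apply/andP; split; lra.
Qed.

Lemma exists_small_half (D d : R) : 0 < d -> exists n, D / 2 ^+ n < d.
Proof.
move=> d0; have [n nP] : exists n : nat, D / d < n%:R.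
  by exists (Num.bound `|D / d|); apply: le_lt_trans (ler_norm _) (archi_boundP (normr_ge0 _)).
exists n; rewrite ltr_pdivrMr ?exprn_gt0// mulrC -ltr_pdivrMr//.
by apply: lt_trans nP _; rewrite -natrX ltr_nat ltn_expl.
Qed.

(** The inner sides cancel, so the integrals over the four quarters add up to the whole; if each had
    modulus below e, the sum would stay below 4 e. *)
Lemma bdint_quarter F x0 x1 y0 y1 x y w h e :
  (forall z, in_rect x0 x1 y0 y1 z -> {for z, continuous F}) ->
  0 <= w -> 0 <= h -> x0 <= x -> x + w + w <= x1 -> y0 <= y -> y + h + h <= y1 ->
  4 * e <= nrm (bdint F x (x + w + w) y (y + h + h)) ->
  exists x' y', [/\ x' = x \/ x' = x + w, y' = y \/ y' = y + h &
    e <= nrm (bdint F x' (x' + w) y' (y' + h))].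
Proof.
move=> cF w0 h0 xl xr yl yr.
have ec u0 u1 v0 v1 := @edge_cts_sub F x0 x1 y0 y1 u0 u1 v0 v1 cF.
have hx : x <= x + w <= x + w + w by rewrite !lerDl w0.
have hy : y <= y + h <= y + h + h by rewrite !lerDl h0.
have yb : y <= y + h + h by case/andP: hy; apply: le_trans.
have xm : x + w <= x1 by apply: le_trans xr; case/andP: hx.
have xm0 : x0 <= x + w by apply: le_trans xl _; case/andP: hx.
have xb : x <= x + w + w by case/andP: hx; apply: le_trans.
rewrite (bdint_catx hx); last exact: ec.
rewrite (bdint_caty hy); last by apply: ec => //; case/andP: hx.
rewrite (bdint_caty (x0 := x + w) hy); last by apply: ec => //; case/andP: hx.
have key (A B D E : C) : 4 * e <= nrm (A + B + (D + E)) ->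
    [\/ e <= nrm A, e <= nrm B, e <= nrm D | e <= nrm E].
  have [hA _|hA] := leP e (nrm A); first by constructor 1.
  have [hB _|hB] := leP e (nrm B); first by constructor 2.
  have [hD _|hD] := leP e (nrm D); first by constructor 3.
  have := nrmD (A + B) (D + E); have := nrmD A B; have := nrmD D E.
  move: hA hB hD; clear => ? ? ? ? ? ? ?; constructor 4; lra.
case/key => H.
- by exists x, y; split; [left|left|].
- by exists x, (y + h); split; [left|right|].
- by exists (x + w), y; split; [right|left|].
- by exists (x + w), (y + h); split; [right|right|].
Qed.

(** Subtracting the affine function F(c) + l (z - c) leaves the boundary integral unchanged. The
    remainder is at most e times the half-perimeter, and integrating it gives the half-perimeter a
    second time. *)
Lemma bdint_small F x0 x1 y0 y1 (c l : C) e :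
  (forall z, in_rect x0 x1 y0 y1 z -> {for z, continuous F}) ->
  x0 <= x1 -> y0 <= y1 -> in_rect x0 x1 y0 y1 c -> 0 <= e ->
  (forall z, in_rect x0 x1 y0 y1 z ->
     nrm (F z - F c - l * (z - c)) <= e * nrm (z - c)) ->
  nrm (bdint F x0 x1 y0 y1) <= 4 * e * ((x1 - x0) + (y1 - y0)) ^+ 2.
Proof.
move=> cF x01 y01 [/andP[c1 c2] /andP[c3 c4]] e0 H.
have eF : edge_cts F x0 x1 y0 y1 by move=> z /(on_edge_in_rect x01 y01); exact: cF.
have eA : edge_cts (fun z => (l * c - F c) + (- l) * z) x0 x1 y0 y1.
  by move=> z _; exact: cts_affine.
have := bdintD eF eA; rewrite bdint_affine// addr0 => <-.
rewrite expr2 mulrA -[4 * e * _]mulrA.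
apply: bdint_bound; [exact: x01|exact: y01| |].
  by move=> z ez; apply: (@cvgD _ _ _ (nbhs z)); [exact: eF|exact: eA].
move=> z /(on_edge_in_rect x01 y01) zr.
have -> : F z + (l * c - F c + - l * z) = F z - F c - l * (z - c) by ring.
apply: le_trans (H _ zr) _; apply: ler_wpM2l => //.
case: zr => /andP[z1 z2] /andP[z3 z4].
rewrite (le_trans (nrm_le_ReIm _))// -/(ReC _) ReCD ImCD ReCN ImCN.
apply: lerD; rewrite ler_norml; apply/andP; split.
- move: z1 c2; clear; lra.
- move: z2 c1; clear; lra.
- move: z3 c4; clear; lra.
- move: z4 c3; clear; lra.
Qed.

(** A nonzero integral would leave, after n quarterings, a box whose integral is at least I0 / 4^n.
    Differentiability at the common point of the boxes bounds it by an arbitrarily small multiple of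
    1 / 4^n. *)
Lemma goursat F x0 x1 y0 y1 : x0 <= x1 -> y0 <= y1 ->
  (forall z, in_rect x0 x1 y0 y1 z -> derivable F z 1) ->
  bdint F x0 x1 y0 y1 = 0.
Proof.
move=> x01 y01 dF.
have cF z : in_rect x0 x1 y0 y1 z -> {for z, continuous F}.
  by move=> /dF; exact: derivable_continuous_at.
set w := x1 - x0; set h := y1 - y0.
have w0 : 0 <= w by rewrite subr_ge0.
have h0 : 0 <= h by rewrite subr_ge0.
set I0 := nrm (bdint F x0 x1 y0 y1).
apply/eqP; rewrite -nrm_eq0 -/I0; apply/negPn/negP => I0n.
have I0p : 0 < I0 by rewrite lt_def I0n nrm_ge0.
(* The box stays inside the original rectangle and keeps at least the share 1 / 4^n of the
   integral. *)
pose P n x y := [/\ x0 <= x /\ x + w / 2 ^+ n <= x1, y0 <= y /\ y + h / 2 ^+ n <= y1 &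
  I0 / 4 ^+ n <= nrm (bdint F x (x + w / 2 ^+ n) y (y + h / 2 ^+ n))].
have halfge0 (v : R) n : 0 <= v -> 0 <= v / 2 ^+ n.
  by move=> ?; rewrite divr_ge0// exprn_ge0.
have half (v u : R) n : u + v / 2 ^+ n = u + v / 2 ^+ n.+1 + v / 2 ^+ n.+1.
  by rewrite exprS; field; rewrite expf_neq0.
have [|n x y [[xl xr] [yl yr] HI]|cx [cy cP]] := @bisection R P w h x0 y0 w0 h0.
- rewrite /P !expr0 !divr1 /w /h [x0 + _]addrC subrK [y0 + _]addrC subrK.
  by split; [split|split|exact: lexx].
- have w'0 := halfge0 w n.+1 w0; have h'0 := halfge0 h n.+1 h0.
  have eI : I0 / 4 ^+ n = 4 * (I0 / 4 ^+ n.+1) by rewrite exprS; field; rewrite expf_neq0.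
  rewrite (half w) in xr HI; rewrite (half h) in yr HI; rewrite eI in HI.
  have [x' [y' [Hx Hy HI']]] := bdint_quarter cF w'0 h'0 xl xr yl yr HI.
  exists x', y'; split=> //; split=> //.
    case: Hx => ->; first by split=> //; move: xr w'0; clear; lra.
    by split=> //; move: xl w'0; clear; lra.
  case: Hy => ->; first by split=> //; move: yr h'0; clear; lra.
  by split=> //; move: yl h'0; clear; lra.
have cin : in_rect x0 x1 y0 y1 (mkC cx cy).
  have [x [y [/andP[a1 a2] /andP[a3 a4] [[a5 a6] [a7 a8] _]]]] := cP 0%N.
  split; rewrite /ReC /ImC /=; apply/andP; split.
  - exact: le_trans a1.
  - exact: le_trans a6.
  - exact: le_trans a3.
  - exact: le_trans a8.
set c := mkC cx cy in cin.
have /is_derive_eps H := derivable_is_derive1 (dF _ cin).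
set l := derive1 F c in H.
set T := w + h.
have T1 : 0 < 8 * (T ^+ 2 + 1) by rewrite mulr_gt0// ltr_wpDl// sqr_ge0.
(* Chosen so that 4 e T^2 < I0; the added 1 covers T = 0. *)
set e := I0 / (8 * (T ^+ 2 + 1)).
have e0 : 0 < e by rewrite divr_gt0.
have [d d0 Hd] := H e e0.
have [n nP] := exists_small_half T d0.
have [x [y [/andP[xc cx'] /andP[yc cy'] [[xl xr] [yl yr] HI]]]] := cP n.
have wn := halfge0 w n w0; have hn := halfge0 h n h0.
have Tn : T / 2 ^+ n = w / 2 ^+ n + h / 2 ^+ n by rewrite mulrDl.
have sub z : in_rect x (x + w / 2 ^+ n) y (y + h / 2 ^+ n) z -> in_rect x0 x1 y0 y1 z.
  move=> [/andP[z1 z2] /andP[z3 z4]]; split; apply/andP; split.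
  - exact: le_trans z1.
  - exact: le_trans xr.
  - exact: le_trans z3.
  - exact: le_trans yr.
have bnd : nrm (bdint F x (x + w / 2 ^+ n) y (y + h / 2 ^+ n)) <=
   4 * e * ((x + w / 2 ^+ n - x) + (y + h / 2 ^+ n - y)) ^+ 2.
  apply: (@bdint_small _ _ _ _ _ c l) => //.
  - by move=> z /sub; exact: cF.
  - by rewrite lerDl.
  - by rewrite lerDl.
  - by split; apply/andP.
  - exact: ltW.
  move=> z [/andP[z1 z2] /andP[z3 z4]]; apply/Hd/(le_lt_trans _ nP).
  rewrite (le_trans (nrm_le_ReIm _))// -/(ReC _) ReCD ImCD ReCN ImCN Tn.
  rewrite -[ReC c]/cx -[ImC c]/cy.
  apply: lerD; rewrite ler_norml; apply/andP; split.
  - move: z1 cx'; clear; lra.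
  - move: z2 xc; clear; lra.
  - move: z3 cy'; clear; lra.
  - move: z4 yc; clear; lra.
have := le_trans HI bnd.
have -> : (x + w / 2 ^+ n - x) + (y + h / 2 ^+ n - y) = T / 2 ^+ n by rewrite Tn; ring.
have -> : 4 * e * (T / 2 ^+ n) ^+ 2 = (4 * e * T ^+ 2) / 4 ^+ n.
  have -> : (4 : R) ^+ n = 2 ^+ n * 2 ^+ n by rewrite -exprMn; congr (_ ^+ n); ring.
  by field; rewrite expf_neq0.
rewrite ler_pM2r ?invr_gt0 ?exprn_gt0//.
rewrite leNgt => /negP; apply.
have -> : 4 * e * T ^+ 2 = (4 * T ^+ 2 * I0) / (8 * (T ^+ 2 + 1)) by rewrite /e; ring.
rewrite ltr_pdivrMr// [I0 * _]mulrC ltr_pM2r//.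
by have := sqr_ge0 T; clear; lra.
Qed.

(** Around a small square centred at a, the rectangle splits into four rectangles that miss a and
    have zero integral. On the square F is bounded by continuity, so its integral tends to 0 with
    the side. *)
Lemma goursat_punctured F x0 x1 y0 y1 (a : C) :
  x0 < ReC a < x1 -> y0 < ImC a < y1 ->
  {for a, continuous F} ->
  (forall z, in_rect x0 x1 y0 y1 z -> z != a -> derivable F z 1) ->
  bdint F x0 x1 y0 y1 = 0.
Proof.
move=> /andP[ax0 ax1] /andP[ay0 ay1] ca dF.
have cF z : in_rect x0 x1 y0 y1 z -> {for z, continuous F}.
  by move=> zr; have [->//|za] := eqVneq z a; apply/derivable_continuous_at/dF.
have /continuousCP/(_ _ ltr01)[r r0 Hr] := ca.
set M := nrm (F a) + 1.
have M0 : 0 < M by rewrite ltr_wpDl ?nrm_ge0.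
(* The square of half-side d < m lies within 2 d < r of a, where the modulus of F is at most M; the
   other terms keep it inside the rectangle. *)
set m := Num.min (r / 3) (Num.min (Num.min (ReC a - x0) (x1 - ReC a))
  (Num.min (ImC a - y0) (y1 - ImC a))).
have m0 : 0 < m by rewrite !lt_min !subr_gt0 ax0 ax1 ay0 ay1 divr_gt0.
(* The half-perimeter of the square is 4 d, hence 4 * M * (4 d). *)
have bnd d : 0 < d -> d < m -> nrm (bdint F x0 x1 y0 y1) <= 16 * M * d.
  move=> d0; rewrite !lt_min => /andP[dr /andP[/andP[d1 d2] /andP[d3 d4]]].
  have ec u0 u1 v0 v1 := @edge_cts_sub F x0 x1 y0 y1 u0 u1 v0 v1 cF.
  have g0 u0 u1 v0 v1 : x0 <= u0 -> u0 <= u1 -> u1 <= x1 -> y0 <= v0 -> v0 <= v1 -> v1 <= y1 ->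
     ~ in_rect u0 u1 v0 v1 a -> bdint F u0 u1 v0 v1 = 0.
    move=> h1 h2 h3 h4 h5 h6 na; apply: goursat; [exact: h2|exact: h5|] => z zr.
    apply: dF; last by apply: contra_not_neq na => <-.
    case: zr => /andP[z1 z2] /andP[z3 z4]; split; apply/andP; split.
    - exact: le_trans z1.
    - exact: le_trans h3.
    - exact: le_trans z3.
    - exact: le_trans h6.
  have [xl xr] : x0 <= ReC a - d /\ ReC a + d <= x1.
    by move: d1 d2; clear; lra.
  have [yl yr] : y0 <= ImC a - d /\ ImC a + d <= y1.
    by move: d3 d4; clear; lra.
  have [xm ym] : ReC a - d <= ReC a + d /\ ImC a - d <= ImC a + d.
    by move: d0; clear; lra.
  have [ux vx] : ReC a - d <= x1 /\ x0 <= ReC a + d.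
    by split; [exact: le_trans xr|exact: le_trans xm].
  have [uy vy] : ImC a - d <= y1 /\ y0 <= ImC a + d.
    by split; [exact: le_trans yr|exact: le_trans ym].
  have x01 : x0 <= x1 by exact: le_trans xr.
  have y01 : y0 <= y1 by exact: le_trans yr.
  have bx1 : x0 <= ReC a - d <= x1 by rewrite xl.
  have bx2 : ReC a - d <= ReC a + d <= x1 by rewrite xm.
  have by1 : y0 <= ImC a - d <= y1 by rewrite yl.
  have by2 : ImC a - d <= ImC a + d <= y1 by rewrite ym.
  have z1 : bdint F x0 (ReC a - d) y0 y1 = 0.
    apply: (g0 _ _ _ _ (lexx _) xl ux (lexx _) y01 (lexx _)).
    by case=> /andP[_]; rewrite leNgt ltrBlDr ltrDl d0.
  have z2 : bdint F (ReC a + d) x1 y0 y1 = 0.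
    apply: (g0 _ _ _ _ vx xr (lexx _) (lexx _) y01 (lexx _)).
    by case=> /andP[]; rewrite leNgt ltrDl d0.
  have z3 : bdint F (ReC a - d) (ReC a + d) y0 (ImC a - d) = 0.
    apply: (g0 _ _ _ _ xl xm xr (lexx _) yl uy).
    by case=> _ /andP[_]; rewrite leNgt ltrBlDr ltrDl d0.
  have z4 : bdint F (ReC a - d) (ReC a + d) (ImC a + d) y1 = 0.
    apply: (g0 _ _ _ _ xl xm xr vy yr (lexx _)).
    by case=> _ /andP[]; rewrite leNgt ltrDl d0.
  rewrite (bdint_catx bx1 (ec _ _ _ _ (lexx _) x01 (lexx _) (lexx _) y01 (lexx _))) z1.
  rewrite (bdint_catx bx2 (ec _ _ _ _ xl ux (lexx _) (lexx _) y01 (lexx _))) z2.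
  rewrite (bdint_caty by1 (ec _ _ _ _ xl xm xr (lexx _) y01 (lexx _))) z3.
  rewrite (bdint_caty by2 (ec _ _ _ _ xl xm xr yl uy (lexx _))) z4.
  rewrite !add0r !addr0.
  have -> : 16 * M * d = 4 * M * ((ReC a + d - (ReC a - d)) + (ImC a + d - (ImC a - d))).
    by ring.
  apply: bdint_bound; [exact: xm|exact: ym|exact: (ec _ _ _ _ xl xm xr yl ym yr)|].
  move=> z /(on_edge_in_rect xm ym)[/andP[c1 c2] /andP[c3 c4]].
  have za : nrm (z - a) < r.
    rewrite (le_lt_trans (nrm_le_ReIm _))// -/(ReC _) ReCD ImCD ReCN ImCN.
    have q1 : `|ReC z - ReC a| <= d.
      by rewrite ler_norml; apply/andP; split; move: c1 c2; clear; lra.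
    have q2 : `|ImC z - ImC a| <= d.
      by rewrite ler_norml; apply/andP; split; move: c3 c4; clear; lra.
    by move: q1 q2 dr d0; clear; lra.
  have := Hr _ za; have := nrmD (F z - F a) (F a); rewrite subrK /M; clear; lra.
apply/eqP; rewrite -nrm_eq0; apply/negPn/negP => In.
set I0 := nrm _ in bnd In.
have I0p : 0 < I0 by rewrite lt_def In nrm_ge0.
have K0 : 0 < 32 * M by rewrite mulr_gt0.
(* Then 16 M d is at most I0 / 2, contradicting I0 > 0; m / 2 provides the strict d < m. *)
set d := Num.min (m / 2) (I0 / (32 * M)).
have d0 : 0 < d by rewrite lt_min !divr_gt0.
have dm : d < m by rewrite /d gt_min; apply/orP; left; lra.
have := bnd d d0 dm.
have : d <= I0 / (32 * M) by rewrite /d ge_min lexx orbT.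
by rewrite ler_pdivlMr//; lra.
Qed.

Lemma is_derive_quotient F (a z l : C) : z != a -> is_derive z 1 F l ->
  derivable (fun w => (F w - F a) * (w - a)^-1) z 1.
Proof.
move=> za dF.
apply: derivableM.
  by apply: derivableB; [exact: is_derive_derivable dF|exact: derivable_cst].
apply: derivableV; first by rewrite subr_eq0.
by apply: derivableB; [exact: derivable_id|exact: derivable_cst].
Qed.

Lemma near_neq (a z : C) : z != a -> \near z, z != a.
Proof.
move=> za; apply/nbhsCP; exists (nrm (z - a)); first by rewrite nrm_gt0 subr_eq0.
by move=> w wz; apply: contraTneq wz => ->; rewrite nrmB ltxx.
Qed.

(** The difference quotient of F at a is continuous at a and differentiable elsewhere, so its
    boundary integral vanishes; splitting it on the boundary gives the equality. *)
Lemma cauchy_formula F x0 x1 y0 y1 (a : C) :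
  x0 < ReC a < x1 -> y0 < ImC a < y1 ->
  (forall z, in_rect x0 x1 y0 y1 z -> derivable F z 1) ->
  bdint (fun z => F z * (z - a)^-1) x0 x1 y0 y1 =
  F a * bdint (fun z => (z - a)^-1) x0 x1 y0 y1.
Proof.
move=> ax ay dF.
(* The value F'(a) at a is the one that makes the quotient continuous. *)
pose G z := if z == a then derive1 F a else (F z - F a) * (z - a)^-1.
have [ax0 ax1] := andP ax; have [ay0 ay1] := andP ay.
have ain : in_rect x0 x1 y0 y1 a by split; apply/andP; split; apply: ltW.
have edge_neq z : on_edge x0 x1 y0 y1 z -> z != a.
  move=> ez; apply/negP => /eqP E; subst z.
  by case: ez => [[_ [E|E]]|[_ [E|E]]]; lra.
have dG z : in_rect x0 x1 y0 y1 z -> z != a -> derivable G z 1.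
  move=> /dF /derivable_is_derive1 dz za.
  apply: near_eq_derivable (is_derive_quotient za dz).
  by apply: filterS (near_neq za) => w wa; rewrite /G (negbTE wa).
have cG : {for a, continuous G}.
  have /is_derive_eps H := derivable_is_derive1 (dF _ ain).
  apply/continuousCP => e e0; have [d d0 Hd] := H _ (divr_gt0 e0 (ltr0Sn _ 1)).
  exists d => // w wa; rewrite /G eqxx; case: eqVneq => [_|nwa].
    by rewrite subrr nrm0.
  have nw : 0 < nrm (w - a) by rewrite nrm_gt0 subr_eq0.
  have wa0 : w - a != 0 by rewrite subr_eq0.
  have -> : (F w - F a) * (w - a)^-1 - derive1 F a =
     (F w - F a - derive1 F a * (w - a)) * (w - a)^-1 by rewrite [RHS]mulrBl mulfK.
  rewrite nrmM nrmV ltr_pdivrMr//; apply: le_lt_trans (Hd _ wa) _.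
  by rewrite ltr_pM2r//; lra.
have G0 := goursat_punctured ax ay cG dG.
have x01 : x0 <= x1 by apply: ltW; apply: lt_trans ax1.
have y01 : y0 <= y1 by apply: ltW; apply: lt_trans ay1.
have eG : edge_cts G x0 x1 y0 y1.
  move=> z ez; apply/derivable_continuous_at/dG; last exact: edge_neq.
  exact: on_edge_in_rect.
have eI : edge_cts (fun z => (z - a)^-1) x0 x1 y0 y1.
  move=> z ez; apply/derivable_continuous_at/derivableV.
    by rewrite subr_eq0 edge_neq.
  by apply: derivableB; [exact: derivable_id|exact: derivable_cst].
have eFI : edge_cts (fun z => F a * (z - a)^-1) x0 x1 y0 y1.
  by move=> z ez; apply: (@cvgM _ _ (nbhs z)); [exact: cvg_cst|exact: eI].
rewrite -bdintZ// -[RHS]add0r -G0 -bdintD//.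
apply: eq_bdint => z /edge_neq za; rewrite /G (negbTE za).
by rewrite -mulrDl subrK.
Qed.

End Goursat.

(** * Regularity of holomorphic functions *)

Section Holomorphic.
Variable R : realType.
Local Open Scope complex_scope.
Local Notation C := (Cplx R).
Implicit Types (F G phi : C -> C).

Lemma ReC_cint (g : R -> C) a b : ReC (cint g a b) = rint (fun x => ReC (g x)) a b.
Proof. by []. Qed.

Lemma ImC_cint (g : R -> C) a b : ImC (cint g a b) = rint (fun x => ImC (g x)) a b.
Proof. by []. Qed.

Lemma ReCV (z : C) : ReC z^-1 = ReC z / (ReC z ^+ 2 + ImC z ^+ 2).
Proof. by case: z. Qed.

Lemma ImCV (z : C) : ImC z^-1 = - (ImC z / (ReC z ^+ 2 + ImC z ^+ 2)).
Proof. by case: z. Qed.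

Lemma rint_lt0 (u : R -> R) a b : a < b -> cts_on u a b ->
  (forall x, a <= x <= b -> u x < 0) -> rint u a b < 0.
Proof.
move=> ab uc H; rewrite -oppr_gt0 -mulN1r -rintZ//; apply: rint_gt0 => //.
  exact: cts_onZ.
by move=> x /H; rewrite mulN1r oppr_gt0.
Qed.

Lemma sum_sqr_gt0 (a b : R) : a != 0 \/ b != 0 -> 0 < a ^+ 2 + b ^+ 2.
Proof.
case=> H.
  by rewrite ltr_pwDl ?sqr_ge0// lt_def sqr_ge0 andbT sqrf_eq0.
by rewrite ltr_wpDl ?sqr_ge0// lt_def sqr_ge0 andbT sqrf_eq0.
Qed.

Lemma edge_neq x0 x1 y0 y1 (a z : C) : x0 < ReC a < x1 -> y0 < ImC a < y1 ->
  on_edge x0 x1 y0 y1 z -> z != a.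
Proof.
move=> /andP[ax0 ax1] /andP[ay0 ay1] ez; apply/negP => /eqP E; subst z.
by move: ax0 ax1 ay0 ay1; case: ez => [[_ [->|->]]|[_ [->|->]]]; rewrite ltxx.
Qed.

Lemma cts_inv_pow (a z : C) k : z != a -> {for z, continuous (fun z => (z - a)^-1 ^+ k)}.
Proof.
move=> za; have c : {for z, continuous (fun z => (z - a)^-1)}.
  apply/derivable_continuous_at/derivableV; first by rewrite subr_eq0.
  by apply: derivableB; [exact: derivable_id|exact: derivable_cst].
elim: k => [|k IH]; first by exact: (@cvg_cst _ (1 : C) _ (nbhs z) _).
rewrite (_ : (fun z => _) = (fun z => (z - a)^-1 * (z - a)^-1 ^+ k)).
  by apply: (@cvgM _ _ (nbhs z)); [exact: c|exact: IH].
by apply: funext => w; rewrite exprS.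
Qed.

Lemma bdint_inv_neq0 x0 x1 y0 y1 (a : C) : x0 < ReC a < x1 -> y0 < ImC a < y1 ->
  bdint (fun z => (z - a)^-1) x0 x1 y0 y1 != 0.
Proof.
move=> ax ay.
have ec : edge_cts (fun z => (z - a)^-1) x0 x1 y0 y1.
  by move=> z /(edge_neq ax ay) za; exact: (cts_inv_pow (k := 1) za).
have [c1 c2 c3 c4] := edge_cts_sides ec.
move: ax ay => /andP[ax0 ax1] /andP[ay0 ay1].
have x01 := lt_trans ax0 ax1; have y01 := lt_trans ay0 ay1.
suff : 0 < ImC (bdint (fun z => (z - a)^-1) x0 x1 y0 y1).
  by move=> H; apply/negP => /eqP E; rewrite E ltxx in H.
(* Since Im (i w) = Re w, the horizontal sides enter through Im 1/(z - a) and the vertical ones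
   through Re 1/(z - a), each of constant sign on its side. *)
rewrite /bdint ImCD ImCD ImCN ImCM [ReC (mkC 0 1)]/(0) [ImC (mkC 0 1)]/(1).
rewrite mul0r add0r mul1r.
rewrite !ImC_cint !ReCD ReCN !ReC_cint.
have b1 : 0 < rint (fun x => ImC (mkC x y0 - a)^-1) x0 x1.
  apply: rint_gt0; [exact: x01|exact: ccts_on_Im c1|] => x _.
  rewrite ImCV ImCD ImCN -mulNr divr_gt0// ?oppr_gt0 ?subr_lt0//.
  by apply: sum_sqr_gt0; right; rewrite lt_eqF// subr_lt0.
have b2 : rint (fun x => ImC (mkC x y1 - a)^-1) x0 x1 < 0.
  apply: rint_lt0; [exact: x01|exact: ccts_on_Im c2|] => x _.
  rewrite ImCV ImCD ImCN oppr_lt0 divr_gt0// ?subr_gt0//.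
  by apply: sum_sqr_gt0; right; rewrite gt_eqF// subr_gt0.
have b3 : 0 < rint (fun y => ReC (mkC x1 y - a)^-1) y0 y1.
  apply: rint_gt0; [exact: y01|exact: ccts_on_Re c3|] => y _.
  rewrite ReCV ReCD ReCN divr_gt0// ?subr_gt0//.
  by apply: sum_sqr_gt0; left; rewrite gt_eqF// subr_gt0.
have b4 : rint (fun y => ReC (mkC x0 y - a)^-1) y0 y1 < 0.
  apply: rint_lt0; [exact: y01|exact: ccts_on_Re c4|] => y _.
  rewrite ReCV ReCD ReCN -oppr_gt0 -mulNr divr_gt0// ?oppr_gt0 ?subr_lt0//.
  by apply: sum_sqr_gt0; left; rewrite lt_eqF// subr_lt0.
by move: b1 b2 b3 b4; clear; lra.
Qed.

Lemma ccts_on_bounded (g : R -> C) a b : ccts_on g a b ->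
  exists2 M, 0 <= M & forall x, a <= x <= b -> nrm (g x) <= M.
Proof.
move=> gc; have [ab|ba] := leP a b; last first.
  by exists 0 => // x /andP[ax xb]; have := le_lt_trans (le_trans ax xb) ba; rewrite ltxx.
have nc : cts_on (fun x => nrm (g x)) a b.
  move=> x xab; apply/cvgrPdist_lt => e e0.
  have /(@cvgCP _ _ (nbhs x))/(_ _ e0) := gc _ xab.
  apply: filterS => y; apply: le_lt_trans; rewrite ler_norml.
  have h1 := nrmD (g x - g y) (g y); have h2 := nrmD (g y - g x) (g x).
  rewrite !subrK in h1 h2; rewrite (nrmB (g x)) in h1.
  by apply/andP; split; move: h1 h2; clear; lra.
have [c _ Hc] := EVT_max ab (cts_on_within nc).
exists (nrm (g c)); first exact: nrm_ge0.
by move=> x xab; apply: Hc; rewrite in_itv.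
Qed.

Lemma edge_cts_bounded F x0 x1 y0 y1 : edge_cts F x0 x1 y0 y1 ->
  exists2 M, 0 <= M & forall z, on_edge x0 x1 y0 y1 z -> nrm (F z) <= M.
Proof.
move=> /edge_cts_sides[c1 c2 c3 c4].
have [M1 M10 H1] := ccts_on_bounded c1; have [M2 M20 H2] := ccts_on_bounded c2.
have [M3 M30 H3] := ccts_on_bounded c3; have [M4 M40 H4] := ccts_on_bounded c4.
exists (M1 + M2 + (M3 + M4)); first by rewrite !addr_ge0.
move=> z [[zx [zy|zy]]|[zy [zx|zx]]]; rewrite [z]mkCE ?zx ?zy.
- by apply: le_trans (H1 _ zx) _; move: M20 M30 M40; clear; lra.
- by apply: le_trans (H2 _ zx) _; move: M10 M30 M40; clear; lra.
- by apply: le_trans (H4 _ zy) _; move: M10 M20 M30; clear; lra.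
- by apply: le_trans (H3 _ zy) _; move: M10 M20 M40; clear; lra.
Qed.

Lemma edge_dist x0 x1 y0 y1 (a : C) : x0 < ReC a < x1 -> y0 < ImC a < y1 ->
  exists2 r, 0 < r & forall z, on_edge x0 x1 y0 y1 z -> r <= nrm (z - a).
Proof.
move=> /andP[ax0 ax1] /andP[ay0 ay1].
set m := Num.min (Num.min (ReC a - x0) (x1 - ReC a)) (Num.min (ImC a - y0) (y1 - ImC a)).
have [m1 m2 m3 m4] : [/\ m <= ReC a - x0, m <= x1 - ReC a, m <= ImC a - y0 & m <= y1 - ImC a].
  by rewrite !ge_min !lexx !orbT.
exists m; first by rewrite !lt_min !subr_gt0 ax0 ax1 ay0 ay1.
move=> z [[_ zy]|[_ zx]].
  apply: le_trans (le_Im_nrm _); rewrite ImCD ImCN; case: zy => ->.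
    by apply: le_trans m3 _; rewrite distrC ler_norm.
  by apply: le_trans m4 _; rewrite ler_norm.
apply: le_trans (le_Re_nrm _); rewrite -/(ReC _) ReCD ReCN; case: zx => ->.
  by apply: le_trans m1 _; rewrite distrC ler_norm.
by apply: le_trans m2 _; rewrite ler_norm.
Qed.

Lemma edge_ctsM F G x0 x1 y0 y1 : edge_cts F x0 x1 y0 y1 -> edge_cts G x0 x1 y0 y1 ->
  edge_cts (fun z => F z * G z) x0 x1 y0 y1.
Proof.
by move=> cF cG z ez; apply: (@cvgM _ _ (nbhs z)); [exact: cF|exact: cG].
Qed.

Lemma edge_ctsD F G x0 x1 y0 y1 : edge_cts F x0 x1 y0 y1 -> edge_cts G x0 x1 y0 y1 ->
  edge_cts (fun z => F z + G z) x0 x1 y0 y1.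
Proof.
by move=> cF cG z ez; apply: (@cvgD _ _ _ (nbhs z)); [exact: cF|exact: cG].
Qed.

Lemma edge_cts_cst (k : C) x0 x1 y0 y1 : edge_cts (fun=> k) x0 x1 y0 y1.
Proof. by move=> z _; exact: (@cvg_cst _ k _ (nbhs z) _). Qed.

(** It is used with u = z - a and d = b - a, so that u - d = z - b. With v = u - d the remainder is
    d^2 / (u^2 v) for k = 1 and d^2 (1 / (u^2 v^2) + 2 / (u^3 v)) for k = 2. The bounds |1/u| <= 1/r
    and |1/v| <= 2/r give 2 / r^3 and 8 / r^4, whose sum serves both cases. *)
Lemma inv_pow_taylor k (u d : C) r : (k = 1%N \/ k = 2%N) -> 0 < r ->
  r <= nrm u -> r / 2 <= nrm (u - d) ->
  nrm ((u - d)^-1 ^+ k - u^-1 ^+ k - d * (k%:R * u^-1 ^+ k.+1)) <=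
  (2 / r ^+ 3 + 8 / r ^+ 4) * nrm d ^+ 2.
Proof.
move=> k12 r0 ru rv; set v := u - d in rv *.
have r20 : 0 < r / 2 by rewrite divr_gt0.
have nu : 0 < nrm u by exact: lt_le_trans ru.
have nv : 0 < nrm v by exact: lt_le_trans rv.
have u0 : u != 0 by rewrite -nrm_gt0.
have v0 : v != 0 by rewrite -nrm_gt0.
have iu : nrm u^-1 <= r^-1 by rewrite nrmV lef_pV2.
have iv : nrm v^-1 <= 2 / r by rewrite nrmV -invf_div lef_pV2.
have ed : d = u - v by rewrite /v opprB addrC subrK.
have p0 := nrm_ge0 u^-1; have q0 := nrm_ge0 v^-1; have d0 := nrm_ge0 d.
have b1 : nrm (d ^+ 2 * (u^-1 ^+ 2 * v^-1)) <= 2 / r ^+ 3 * nrm d ^+ 2.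
  rewrite nrmM nrmX mulrC ler_wpM2r ?sqr_ge0//.
  have -> : 2 / r ^+ 3 = r^-1 ^+ 2 * (2 / r) by field; rewrite gt_eqF.
  by rewrite nrmM nrmX ler_pM ?exprn_ge0// lerXn2r ?nnegrE// invr_ge0 ltW.
have b2 : nrm (d ^+ 2 * (u^-1 ^+ 2 * v^-1 ^+ 2 + 2 * (u^-1 ^+ 3 * v^-1))) <=
    8 / r ^+ 4 * nrm d ^+ 2.
  rewrite nrmM nrmX mulrC ler_wpM2r ?sqr_ge0//.
  have -> : 8 / r ^+ 4 = r^-1 ^+ 2 * (2 / r) ^+ 2 + 2 * (r^-1 ^+ 3 * (2 / r)).
    by field; rewrite gt_eqF.
  apply: le_trans (nrmD _ _) _; apply: lerD.
    rewrite nrmM !nrmX ler_pM ?exprn_ge0// lerXn2r ?nnegrE ?invr_ge0 ?(ltW r0)//.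
    by rewrite divr_ge0 ?(ltW r0).
  rewrite nrmM; apply: ler_pM; rewrite ?nrm_ge0//.
    by rewrite (le_trans (nrmD 1 1))// [nrm 1]Normc.normc1.
  by rewrite nrmM !nrmX ler_pM ?exprn_ge0// lerXn2r ?nnegrE ?invr_ge0 ?(ltW r0).
have r3 : 0 <= 2 / r ^+ 3 * nrm d ^+ 2.
  by rewrite mulr_ge0 ?sqr_ge0// divr_ge0// exprn_ge0// ltW.
have r4 : 0 <= 8 / r ^+ 4 * nrm d ^+ 2.
  by rewrite mulr_ge0 ?sqr_ge0// divr_ge0// exprn_ge0// ltW.
rewrite mulrDl; case: k12 => ->.
  have -> : v^-1 ^+ 1 - u^-1 ^+ 1 - d * (1%:R * u^-1 ^+ 2) = d ^+ 2 * (u^-1 ^+ 2 * v^-1).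
    by rewrite ed; field; apply/andP.
  by apply: le_trans b1 _; rewrite lerDl.
have -> : v^-1 ^+ 2 - u^-1 ^+ 2 - d * (2%:R * u^-1 ^+ 3) =
    d ^+ 2 * (u^-1 ^+ 2 * v^-1 ^+ 2 + 2 * (u^-1 ^+ 3 * v^-1)).
  by rewrite ed; field; apply/andP.
by apply: le_trans b2 _; rewrite lerDr.
Qed.

(** The increment of the integrand minus its linear part is phi times the Taylor remainder of the
    kernel, at most M K |b - a|^2 uniformly on the boundary; integration preserves the square. The
    exponents 1 and 2 correspond to differentiating Cauchy's formula twice. *)
Lemma is_derive_cauchy_kernel phi x0 x1 y0 y1 (a : C) k : (k = 1%N \/ k = 2%N) ->
  x0 < ReC a < x1 -> y0 < ImC a < y1 -> edge_cts phi x0 x1 y0 y1 ->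
  is_derive a 1 (fun b => bdint (fun z => phi z * (z - b)^-1 ^+ k) x0 x1 y0 y1)
    (k%:R * bdint (fun z => phi z * (z - a)^-1 ^+ k.+1) x0 x1 y0 y1).
Proof.
move=> k12 ax ay cphi.
have [r r0 Hr] := edge_dist ax ay.
have [M M0 HM] := edge_cts_bounded cphi.
have x01 : x0 <= x1 by case/andP: ax => h1 h2; exact: ltW (lt_trans h1 h2).
have y01 : y0 <= y1 by case/andP: ay => h1 h2; exact: ltW (lt_trans h1 h2).
set K := 2 / r ^+ 3 + 8 / r ^+ 4.
set L := (x1 - x0) + (y1 - y0).
have cK b j : nrm (b - a) < r / 2 ->
    edge_cts (fun z => phi z * (z - b)^-1 ^+ j) x0 x1 y0 y1.
  move=> ba; apply: (@edge_ctsM phi (fun z => (z - b)^-1 ^+ j) _ _ _ _ cphi) => z ez; apply: cts_inv_pow.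
  apply: contraTneq ba => <-; rewrite -leNgt; apply: le_trans (Hr _ ez).
  by rewrite ler_pdivrMr// ler_peMr ?ler1n// ltW.
have ca : nrm (a - a) < r / 2 by rewrite subrr nrm0 divr_gt0.
apply: (@is_derive_sq_bound _ _ _ _ (4 * (M * K) * L) (r / 2)); first by rewrite divr_gt0.
move=> b ba.
have c1 := cK b k ba; have c2 := cK a k ca; have c3 := cK a k.+1 ca.
set d := b - a in ba *.
(* Differences are written as sums with scalar factors, the shape to which linearity of [bdint]
   applies. *)
have c2' : edge_cts (fun z => -1 * (phi z * (z - a)^-1 ^+ k)) x0 x1 y0 y1.
  exact: (@edge_ctsM (fun=> -1) _ _ _ _ _ (@edge_cts_cst (-1) _ _ _ _) c2).
have c3' : edge_cts (fun z => - (k%:R * d) * (phi z * (z - a)^-1 ^+ k.+1)) x0 x1 y0 y1.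
  exact: (@edge_ctsM (fun=> - (k%:R * d)) _ _ _ _ _ (@edge_cts_cst (- (k%:R * d)) _ _ _ _) c3).
have c12 := edge_ctsD c1 c2'; have c123 := edge_ctsD c12 c3'.
have E := bdintD c12 c3'; rewrite (bdintD c1 c2') (bdintZ _ c2) (bdintZ _ c3) in E.
have E2 (p q v : C) : p + -1 * q + - (k%:R * d) * v = p - q - k%:R * v * d by ring.
rewrite E2 in E; apply: (@le_trans _ _ (nrm (bdint (fun z => phi z * (z - b)^-1 ^+ k +
  -1 * (phi z * (z - a)^-1 ^+ k) + - (k%:R * d) * (phi z * (z - a)^-1 ^+ k.+1)) x0 x1 y0 y1))).
  by rewrite E.
have -> : 4 * (M * K) * L * nrm d ^+ 2 = 4 * (M * (K * nrm d ^+ 2)) * L by ring.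
apply: bdint_bound; [exact: x01|exact: y01|exact: c123|] => z ez.
have E3 (p q v w : C) : p * q + -1 * (p * v) + - (k%:R * d) * (p * w) =
  p * (q - v - d * (k%:R * w)) by ring.
have zb : z - b = z - a - d by rewrite /d opprB addrA subrK.
rewrite E3 zb nrmM; apply: ler_pM; rewrite ?nrm_ge0//; first exact: HM.
apply: inv_pow_taylor; [exact: k12|exact: r0|exact: Hr|].
have h1 := Hr _ ez; have h2 := nrmD (z - a - d) d; rewrite subrK in h2.
by move: h1 h2 ba; clear; lra.
Qed.

Lemma holomorphic_derive1 F (z0 : C) (r0 : R) : 0 < r0 ->
  (forall z, nrm (z - z0) < r0 -> derivable F z 1) ->
  derivable (derive1 F) z0 1.
Proof.
(* Points of the square of half-side s are within 2 s < r0 of z0. *)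
move=> r00 dF; set s := r0 / 3.
have s0 : 0 < s by rewrite divr_gt0.
set x0 := ReC z0 - s; set x1 := ReC z0 + s; set y0 := ImC z0 - s; set y1 := ImC z0 + s.
have dR z : in_rect x0 x1 y0 y1 z -> derivable F z 1.
  move=> [/andP[z1 z2] /andP[z3 z4]]; apply: dF.
  rewrite (le_lt_trans (nrm_le_ReIm _))// -/(ReC _) ReCD ImCD ReCN ImCN.
  have q1 : `|ReC z - ReC z0| <= s.
    by rewrite ler_norml; apply/andP; split; move: z1 z2; rewrite /x0 /x1; clear; lra.
  have q2 : `|ImC z - ImC z0| <= s.
    by rewrite ler_norml; apply/andP; split; move: z3 z4; rewrite /y0 /y1; clear; lra.
  by move: q1 q2 s0; rewrite /s; clear; lra.
have near_in a : nrm (a - z0) < s -> x0 < ReC a < x1 /\ y0 < ImC a < y1.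
  move=> az; have := le_lt_trans (le_Re_nrm _) az; have := le_lt_trans (le_Im_nrm _) az.
  rewrite -/(ReC _) ReCD ImCD ReCN ImCN !ltr_norml => /andP[h1 h2] /andP[h3 h4].
  by split; apply/andP; split; rewrite /x0 /x1 /y0 /y1; [move: h3|move: h4|move: h1|move: h2]; clear; lra.
have x01 : x0 <= x1 by move: s0; rewrite /x0 /x1; clear; lra.
have y01 : y0 <= y1 by move: s0; rewrite /y0 /y1; clear; lra.
have cF : edge_cts F x0 x1 y0 y1.
  move=> z /(on_edge_in_rect x01 y01) /dR; exact: derivable_continuous_at.
have c1 : edge_cts (fun=> 1 : C) x0 x1 y0 y1 by exact: edge_cts_cst.
pose N k b := bdint (fun z => F z * (z - b)^-1 ^+ k) x0 x1 y0 y1.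
(* The factor 1 makes J an instance of N for the constant function 1, so both are differentiated by
   the same lemma. *)
pose J k b := bdint (fun z => 1 * (z - b)^-1 ^+ k) x0 x1 y0 y1.
have dN a k : nrm (a - z0) < s -> (k = 1%N \/ k = 2%N) -> is_derive a 1 (N k) (k%:R * N k.+1 a).
  by move=> /near_in[ax ay] k12; exact: is_derive_cauchy_kernel.
have dJ a k : nrm (a - z0) < s -> (k = 1%N \/ k = 2%N) -> is_derive a 1 (J k) (k%:R * J k.+1 a).
  by move=> /near_in[ax ay] k12; exact: is_derive_cauchy_kernel.
have J0 a : nrm (a - z0) < s -> J 1%N a != 0.
  move=> /near_in[ax ay].
  rewrite /J (@eq_bdint _ _ (fun z => (z - a)^-1)).
    exact: bdint_inv_neq0.
  by move=> z _; rewrite mul1r expr1.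
have FE a : nrm (a - z0) < s -> F a = N 1%N a * (J 1%N a)^-1.
  move=> as0; have [ax ay] := near_in _ as0.
  apply: (mulIf (J0 _ as0)); rewrite mulfVK ?J0//.
  have := cauchy_formula ax ay dR.
  rewrite /J /N => E; rewrite (@eq_bdint _ _ (fun z => (z - a)^-1)).
    rewrite -E; apply: eq_bdint => z _; by rewrite expr1.
  by move=> z _; rewrite mul1r expr1.
(* The derivative of N / J by the product rule; its ingredients with exponent 2 can be
   differentiated once more. *)
pose D a := 1%:R * N 2%N a * (J 1%N a)^-1 + N 1%N a * (- (1%:R * J 2%N a) / J 1%N a ^+ 2).
have near_s a : nrm (a - z0) < s -> \near a, nrm (a - z0) < s.
  move=> as0; apply/nbhsCP; exists (s - nrm (a - z0)); first by rewrite subr_gt0.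
  move=> w wa; have := nrm_tri w a z0; move: wa; clear; lra.
have dFE a : nrm (a - z0) < s -> derive1 F a = D a.
  move=> as0; apply: derive1_val.
  have k1 : 1%N = 1%N \/ 1%N = 2%N by left.
  apply: near_eq_is_derive1 (is_derive_prod (dN _ _ as0 k1)
    (is_derive_inv (J0 _ as0) (dJ _ _ as0 k1))).
  by apply: filterS (near_s _ as0) => w ws; rewrite -FE.
have z00 : nrm (z0 - z0) < s by rewrite subrr nrm0.
have dD : derivable D z0 1.
  have n1 := is_derive_derivable (dN _ _ z00 (or_introl erefl)).
  have n2 := is_derive_derivable (dN _ _ z00 (or_intror erefl)).
  have j1 := is_derive_derivable (dJ _ _ z00 (or_introl erefl)).
  have j2 := is_derive_derivable (dJ _ _ z00 (or_intror erefl)).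
  have j10 := J0 _ z00.
  apply: derivableD.
    apply: derivableM; last exact: (derivableV j10 j1).
    by apply: derivableM; [exact: derivable_cst|exact: n2].
  apply: derivableM; first exact: n1.
  apply: derivableM.
    by apply: derivableN; apply: derivableM; [exact: derivable_cst|exact: j2].
  by apply: derivableV; [rewrite expf_neq0|exact: (@derivableX _ _ (J 1%N) 2 z0 1 j1)].
apply: near_eq_derivable dD.
by apply: filterS (near_s _ z00) => w ws; rewrite -dFE.
Qed.

End Holomorphic.

(** * Functions with zero derivative *)

Section ZeroDerivative.
Variable R : realType.
Local Open Scope complex_scope.
Local Notation C := (Cplx R).
Implicit Types (f : C -> C) (z w : C).

Definition segC (u v : C) (s : R) : C := u + mkC s 0 * (v - u).

Lemma nrm_mkC0 (s : R) : nrm (mkC s 0 : C) = `|s|.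
Proof. exact: nrm_real. Qed.

Lemma nrm_i : nrm (mkC 0 1 : C) = 1.
Proof. by rewrite /nrm /= expr0n add0r expr1n sqrtr1. Qed.

Lemma segC_sub (u v : C) s s' : segC u v s' - segC u v s = mkC (s' - s) 0 * (v - u).
Proof.
have -> : mkC (s' - s) 0 = mkC s' 0 - mkC s 0 :> C.
  by apply: C_eq; rewrite ?ReCD ?ReCN ?ImCD ?ImCN /ReC /ImC /= ?subr0.
by rewrite /segC; ring.
Qed.

(** [pr] stands for [ReC] or [ImC]; only compatibility with differences and a bound by the modulus
    matter. *)
Lemma real_derive0 f (u v : C) (s : R) (pr : C -> R) :
  (forall z w, pr (z - w) = pr z - pr w) -> (forall z, `|pr z| <= nrm z) ->
  is_derive (segC u v s) 1 f 0 -> is_derive s 1 (fun s => pr (f (segC u v s))) 0.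
Proof.
move=> prB prle /is_derive_eps H.
set L := nrm (v - u) + 1.
have L0 : 0 < L by rewrite ltr_wpDl// nrm_ge0.
have key : (fun h : R => h^-1 *: (pr (f (segC u v (h *: 1 + s))) - pr (f (segC u v s))))
    @ 0^' --> (0 : R).
  apply/cvgrPdist_le => e e0.
  have [d d0 Hd] := H _ (divr_gt0 e0 L0).
  suff: nbhs (0 : R) (fun h => h != 0 ->
    `|0 - h^-1 *: (pr (f (segC u v (h *: 1 + s))) - pr (f (segC u v s)))| <= e) by [].
  apply/nbhs_ballP; exists (d / L); first by rewrite /= divr_gt0.
  move=> h; rewrite /ball /= sub0r normrN => hd h0.
  have nh : 0 < `|h| by rewrite normr_gt0.
  rewrite sub0r normrN [h *: 1]mulr1 -prB normrM normfV mulrC ler_pdivrMr//.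
  apply: le_trans (prle _) _.
  have sd : segC u v (h + s) - segC u v s = mkC h 0 * (v - u) by rewrite segC_sub addrK.
  have nsd : nrm (segC u v (h + s) - segC u v s) <= `|h| * L.
    by rewrite sd nrmM nrm_mkC0 ler_wpM2l// lerDl.
  have := Hd (segC u v (h + s)); rewrite mul0r subr0 => Hd'.
  apply: le_trans (Hd' _) _.
    by apply: le_lt_trans nsd _; rewrite -ltr_pdivlMr.
  apply: le_trans (ler_wpM2l _ nsd) _; first by rewrite divr_ge0// ltW.
  by rewrite mulrA mulrAC divfK// gt_eqF.
split; first by apply/cvg_ex; exists 0.
exact: cvg_lim key.
Qed.

(** The mean value theorem fails for complex values, so it is applied to the real and the imaginary
    part along the segment. *)
Lemma segC_const f (u v : C) :
  (forall s : R, 0 <= s <= 1 -> is_derive (segC u v s) 1 f 0) -> f u = f v.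
Proof.
move=> H.
have key (pr : C -> R) : (forall z w, pr (z - w) = pr z - pr w) ->
    (forall z, `|pr z| <= nrm z) -> pr (f u) = pr (f v).
  move=> prB prle; pose g s := pr (f (segC u v s)).
  have dg (s : R) : 0 <= s <= 1 -> is_derive s 1 g 0 by move=> /H; exact: real_derive0.
  have [| |c _] := @MVT_segment R g (fun=> 0) 0 1 ler01.
  - by move=> s; rewrite in_itv /= => /andP[s0 s1]; apply: dg; rewrite !ltW.
  - apply: (derivable_within_continuous (i := `[0, 1]%R)) => x; rewrite in_itv /= => /dg.
    by case.
  rewrite mul0r => /eqP; rewrite subr_eq0 => /eqP.
  have -> : g 1 = pr (f v).
    rewrite /g; congr (pr (f _)); rewrite /segC.
    by have -> : mkC 1 0 = 1 :> C by []; rewrite mul1r addrC subrK.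
  have -> // : g 0 = pr (f u).
  rewrite /g; congr (pr (f _)); rewrite /segC.
  by have -> : mkC 0 0 = 0 :> C by []; rewrite mul0r addr0.
apply: C_eq; apply: key.
- by move=> z w; rewrite ReCD ReCN.
- exact: le_Re_nrm.
- by move=> z w; rewrite ImCD ImCN.
- exact: le_Im_nrm.
Qed.

Lemma segC_subz (z u v : C) (s : R) :
  segC u v s - z = mkC (1 - s) 0 * (u - z) + mkC s 0 * (v - z).
Proof.
have -> : mkC (1 - s) 0 = 1 - mkC s 0 :> C.
  by apply: C_eq; rewrite ?ReCD ?ReCN ?ImCD ?ImCN /ReC /ImC /= ?subr0.
by rewrite /segC; ring.
Qed.

Lemma segC_ball (z u v : C) (r s : R) : 0 <= s <= 1 -> nrm (u - z) < r -> nrm (v - z) < r ->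
  nrm (segC u v s - z) < r.
Proof.
move=> /andP[s0 s1] ur vr.
rewrite segC_subz (le_lt_trans (nrmD _ _))// !nrmM !nrm_mkC0.
have s1' : 0 <= 1 - s by rewrite subr_ge0.
rewrite (ger0_norm s0) (ger0_norm s1').
move: (nrm (u - z)) (nrm (v - z)) ur vr => a b ar br.
apply: (@le_lt_trans _ _ (Num.max a b)); last by rewrite gt_max ar.
have ha : (1 - s) * a <= (1 - s) * Num.max a b by rewrite ler_wpM2l// le_max lexx.
have hb : s * b <= s * Num.max a b by rewrite ler_wpM2l// le_max lexx orbT.
by move: ha hb; clear; lra.
Qed.

(* If the segment from [z + d1] to [z + d2] meets [z], the one from [z - d1]
   does not, and [z + d1], [z + 'i d1], [z - d1] are joined by segments off [z]. *)
Lemma punctured_ball_const f (z : C) (r : R) :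
  (forall w, w != z -> nrm (w - z) < r -> is_derive w 1 f 0) ->
  forall w1 w2, w1 != z -> w2 != z -> nrm (w1 - z) < r -> nrm (w2 - z) < r -> f w1 = f w2.
Proof.
move=> H.
have seg u v : nrm (u - z) < r -> nrm (v - z) < r ->
    (forall s : R, 0 <= s <= 1 -> segC u v s != z) -> f u = f v.
  move=> ur vr av; apply: segC_const => s s01.
  by apply: H; [exact: av|exact: segC_ball].
have rot u : u != z -> nrm (u - z) < r -> f u = f (z + mkC 0 1 * (u - z)).
  move=> uz ur; apply: seg => //.
    rewrite addrC addKr nrmM.
    by rewrite nrm_i mul1r.
  move=> s /andP[s0 s1]; rewrite -subr_eq0.
  (* The point at parameter s is z + (1 - s + i s)(u - z), and 1 - s + i s never vanishes. *)
  have -> : segC u (z + mkC 0 1 * (u - z)) s - z = mkC (1 - s) s * (u - z).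
    have -> : mkC (1 - s) s = 1 - mkC s 0 + mkC s 0 * mkC 0 1 :> C.
      by apply: C_eq; rewrite ?ReCM ?ImCM ?ReCD ?ReCN ?ImCD ?ImCN ?ReCM ?ImCM /ReC /ImC /=; ring.
    by rewrite /segC; ring.
  rewrite mulf_neq0 ?subr_eq0//; apply/negP => /eqP E.
  have := congr1 (@ReC R) E; have := congr1 (@ImC R) E; rewrite /ReC /ImC /= => -> /eqP.
  by rewrite subr0 oner_eq0.
have opp u : u != z -> nrm (u - z) < r -> f u = f (z - (u - z)).
  move=> uz ur; rewrite rot//.
  have i0 : mkC 0 1 != 0 :> C by rewrite -nrm_gt0 nrm_i.
  rewrite rot; last 2 first.
  - by rewrite -subr_eq0 addrC addKr mulf_neq0// subr_eq0.
  - by rewrite addrC addKr nrmM nrm_i mul1r.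
  congr f; have i2 : mkC 0 1 * mkC 0 1 = -1 :> C.
    by apply: C_eq; rewrite ?ReCM ?ImCM /ReC /ImC /=; ring.
  by rewrite [z + _ * (u - z)]addrC addrK mulrA i2 mulN1r.
move=> w1 w2 n1 n2 r1 r2.
have [[s s01 sE]|no] := pselect (exists2 s : R, 0 <= s <= 1 & segC w1 w2 s = z); last first.
  by apply: seg => // s s01; apply/negP => /eqP E; apply: no; exists s.
rewrite opp//; apply: seg => //.
  by rewrite [z - _]addrC addrK nrmN.
move=> s' s01'; apply/negP => /eqP sE'.
have e1 : mkC (1 - s) 0 * (w1 - z) + mkC s 0 * (w2 - z) = 0.
  by rewrite -segC_subz sE subrr.
have e2 : - mkC (1 - s') 0 * (w1 - z) + mkC s' 0 * (w2 - z) = 0.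
  have <- : segC (z - (w1 - z)) w2 s' - z = 0 by rewrite sE' subrr.
  by rewrite segC_subz [z - _ - z]addrC addKr mulrN mulNr.
move/andP: s01 => [s0 s1]; move/andP: s01' => [s0' s1'].
(* Eliminating w2 - z between the two relations leaves (1 - s) s' + s (1 - s') = 0. Both terms are
   nonnegative, so s is 0 or 1 and an end point would equal z. *)
have : (mkC (1 - s) 0 * mkC s' 0 + mkC s 0 * mkC (1 - s') 0) * (w1 - z) = 0.
  have -> : (mkC (1 - s) 0 * mkC s' 0 + mkC s 0 * mkC (1 - s') 0) * (w1 - z) =
    mkC s' 0 * (mkC (1 - s) 0 * (w1 - z) + mkC s 0 * (w2 - z)) -
    mkC s 0 * (- mkC (1 - s') 0 * (w1 - z) + mkC s' 0 * (w2 - z)) by ring.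
  by rewrite e1 e2 !mulr0 subrr.
move/eqP; rewrite mulf_eq0 subr_eq0 (negbTE n1) orbF => /eqP /(congr1 (@ReC R)).
rewrite ReCD !ReCM /ReC /ImC /= !mulr0 !subr0 => E1.
have sq (a : R) (c : C) : mkC a 0 * c = 0 -> c != 0 -> a = 0.
  by move=> /eqP; rewrite mulf_eq0 => /orP[/eqP /(congr1 (@ReC R))|/eqP ->]//; rewrite eqxx.
have s00 : s = 0 \/ s = 1.
  have : (1 - s) * s' = 0 /\ s * (1 - s') = 0 by move: E1 s0 s1 s0' s1'; clear => *; split; nra.
  move=> [/eqP + /eqP]; rewrite !mulf_eq0 !subr_eq0.
  move=> /orP[/eqP <-|/eqP ->]; first by right.
  by rewrite eq_sym oner_eq0 orbF => /eqP; left.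
move: e1; case: s00 => ->; rewrite ?subrr ?subr0.
  have -> : mkC 0 0 = 0 :> C by [].
  rewrite mul0r addr0 => /sq; rewrite subr_eq0 => /(_ n1) /eqP; by rewrite oner_eq0.
have -> : mkC 0 0 = 0 :> C by [].
rewrite mul0r add0r => /sq; rewrite subr_eq0 => /(_ n2) /eqP; by rewrite oner_eq0.
Qed.

End ZeroDerivative.

(** * Meromorphic functions on the upper half plane *)

Section Meromorphic.
Variable R : realType.
Local Open Scope complex_scope.
Local Notation C := (Cplx R).
Implicit Types (f t h : C -> C) (z w : C).

Lemma ReC_mkC (x y : R) : ReC (mkC x y) = x. Proof. by []. Qed.

Lemma ImC_mkC (x y : R) : ImC (mkC x y) = y. Proof. by []. Qed.

Lemma uhp_near z : uhp z -> exists2 r : R, 0 < r & forall w, nrm (w - z) < r -> uhp w.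
Proof.
move=> zu; exists (ImC z) => // w wz; rewrite /uhp /=.
have := le_lt_trans (le_Im_nrm _) wz; rewrite ImCD ImCN ltr_norml => /andP[].
by clear; lra.
Qed.

Lemma poles_discrete f P z : meromorphic_uhp f P -> uhp z ->
  exists2 r : R, 0 < r & forall w, nrm (w - z) < r -> w != z -> ~ P w.
Proof.
move=> [_ [H _]] /H[_ /posC[r r0 ->] Hr]; exists r => // w wz; apply: Hr.
by rewrite normc_lt.
Qed.

Lemma meromorphic_near f P z : meromorphic_uhp f P -> uhp z -> ~ P z ->
  exists2 r : R, 0 < r & forall w, nrm (w - z) < r -> [/\ uhp w, ~ P w & derivable f w 1].
Proof.
move=> mf zu nP; have [r1 r10 H1] := uhp_near zu.
have [r2 r20 H2] := poles_discrete mf zu.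
exists (Num.min r1 r2); first by rewrite lt_min r10.
move=> w; rewrite lt_min => /andP[w1 w2].
have nw : ~ P w by have [->//|wz] := eqVneq w z; exact: H2.
have uw := H1 _ w1.
by split; [exact: uw|exact: nw|case: mf => _ [_ [+ _]]; apply].
Qed.

Lemma exists_near_neq z (r : R) : 0 < r -> exists2 w, w != z & nrm (w - z) < r.
Proof.
move=> r0; have e : nrm (mkC (r / 2) 0 : C) = r / 2.
  by rewrite nrm_mkC0 ger0_norm// divr_ge0// ltW.
exists (z + mkC (r / 2) 0).
  by rewrite -subr_eq0 addrC addKr -nrm_gt0 e divr_gt0.
by rewrite addrC addKr e; move: r0; clear; lra.
Qed.

Lemma near_const_derive0 f z c : (\near z, f z = c) -> is_derive z 1 f 0.
Proof.
move=> H; apply: near_eq_is_derive1 (is_derive_cst c z 1).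
by apply: filterS H => w ->.
Qed.

(* If [t' = 0] off the poles, then [t] is constant on a punctured disc around every
   point of [uhp], poles included; these constants form a function on [uhp] with
   zero derivative, hence constant. *)
Lemma exists_derive1_neq0 t P : meromorphic_uhp t P ->
  (exists z1 z2, uhp z1 /\ uhp z2 /\ ~ P z1 /\ ~ P z2 /\ t z1 != t z2) ->
  exists z, [/\ uhp z, ~ P z & derive1 t z != 0].
Proof.
move=> mt [z1 [z2 [u1 [u2 [n1 [n2 tn]]]]]].
apply: contrapT => no.
have d0 z : uhp z -> ~ P z -> is_derive z 1 t 0.
  move=> zu nP; have dz : derivable t z 1 by case: mt => _ [_ [+ _]]; apply.
  have := derivable_is_derive1 dz.
  have -> // : derive1 t z = 0.
  by apply/eqP/negPn/negP => tz; apply: no; exists z.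
(* The value at z itself is left out, since at a pole it is arbitrary. *)
pose loc z c := exists2 r : R, 0 < r & forall w, w != z -> nrm (w - z) < r -> t w = c.
have loc_uniq z c c' : loc z c -> loc z c' -> c = c'.
  move=> [r r0 H] [r' r'0 H'].
  have [|w wz] := @exists_near_neq z (Num.min r r'); first by rewrite lt_min r0.
  by rewrite lt_min => /andP[wr wr']; rewrite -(H w)// (H' w).
have loc_ex z : uhp z -> exists c, loc z c.
  move=> zu; have [r1 r10 H1] := uhp_near zu; have [r2 r20 H2] := poles_discrete mt zu.
  set r := Num.min r1 r2; have r0 : 0 < r by rewrite lt_min r10.
  have [w0 w0z w0r] := exists_near_neq z r0.
  exists (t w0); exists r => // w wz wr.
  apply: (@punctured_ball_const _ t z r) => // v vz; rewrite lt_min => /andP[v1 v2].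
  by apply: d0; [exact: H1|exact: H2].
have /choice[T HT] : forall z, exists c, uhp z -> loc z c.
  move=> z; have [/loc_ex[c Hc]|nu] := pselect (uhp z); first by exists c.
  by exists 0.
have loc_reg z : uhp z -> ~ P z -> loc z (t z).
  move=> zu nP; have [r r0 H] := meromorphic_near mt zu nP.
  exists r => // w wz wr; apply: segC_const => s s01.
  have [//|uv nv _] := H (segC w z s); last exact: d0.
  by apply: segC_ball => //; rewrite subrr nrm0.
have dT z : uhp z -> is_derive z 1 T 0.
  move=> zu; apply: (@near_const_derive0 _ _ (T z)); apply/nbhsCP.
  have [r r0 Hr] := HT _ zu; have [r1 r10 H1] := uhp_near zu.
  exists (Num.min r r1); first by rewrite lt_min r0.
  move=> w; rewrite lt_min => /andP[wr wr1].
  have [->//|wz] := eqVneq w z.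
  have [r2 r20 H2] := HT _ (H1 _ wr1).
  (* The point v lies in the punctured discs of both w and z, so it compares their constants; the
     second bound gives v <> z, the third keeps v in the disc about z. *)
  have [|v vw] := @exists_near_neq w (Num.min r2 (Num.min (nrm (w - z)) (r - nrm (w - z)))).
    by rewrite !lt_min r20 nrm_gt0 subr_eq0 wz subr_gt0.
  rewrite !lt_min => /and3P[v1 v2 v3].
  rewrite -(H2 v)// -(Hr v)//.
    by apply: contraTneq v2 => ->; rewrite nrmB ltxx.
  by have := nrm_tri v w z; move: v3; clear; lra.
have TE z : uhp z -> ~ P z -> T z = t z.
  by move=> zu nP; exact: loc_uniq (HT _ zu) (loc_reg _ zu nP).
move/eqP: tn; apply; rewrite -!TE//; apply: segC_const => s /andP[s0 s1].
apply: dT; rewrite /uhp /= in u1 u2 *.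
rewrite /segC ImCD ImCM ImCD ImCN ReC_mkC ImC_mkC mul0r addr0.
(* The half plane is convex: one of the weights s and 1 - s is at least 1/2 and contributes a
   positive amount. *)
have [s12|s12] := leP s (1 / 2).
  have := mulr_ge0 s0 (ltW u2); move: s12 u1; clear => *; nra.
have s1' : 0 <= 1 - s by rewrite subr_ge0.
have := mulr_ge0 s1' (ltW u1); move: s12 u2; clear => *; nra.
Qed.

(** A nonzero derivative keeps t(w) away from t(z), and continuity keeps it away from any other
    listed value. Escaping every finite list is the form in which infinitely many values are
    used. *)
Lemma near_avoid_values t z l (s : seq C) : is_derive z 1 t l -> l != 0 ->
  exists2 r : R, 0 < r & forall w, w != z -> nrm (w - z) < r -> t w \notin s.
Proof.
move=> dt l0.
(* With error |l| / 2, equality of t(w) and t(z) would give |l| |w - z| <= |l| |w - z| / 2. *)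
have nl : 0 < nrm l / 2 by rewrite divr_gt0// nrm_gt0.
have [r r0 Hr] := (is_derive_eps _ _ _).1 dt _ nl.
have inj w : w != z -> nrm (w - z) < r -> t w != t z.
  move=> wz wr; have := Hr _ wr; apply: contraTneq => ->.
  rewrite subrr sub0r nrmN nrmM -ltNge ltr_pM2r ?nrm_gt0 ?subr_eq0//.
  by move: nl; clear; lra.
elim: s => [|a s [r' r'0 IH]]; first by exists r.
have ct := derivable_continuous_at (is_derive_derivable dt).
have [az|az] := eqVneq a (t z).
  exists (Num.min r r'); first by rewrite lt_min r0.
  move=> w wz; rewrite lt_min => /andP[wr wr']; rewrite in_cons negb_or IH// andbT az.
  exact: inj.
have [|d d0 Hd] := (continuousCP _ _).1 ct (nrm (a - t z)).
  by rewrite nrm_gt0 subr_eq0.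
exists (Num.min d r'); first by rewrite lt_min d0.
move=> w wz; rewrite lt_min => /andP[wr wr']; rewrite in_cons negb_or IH// andbT.
by apply: contraTneq (Hd _ wr) => ->; rewrite ltxx.
Qed.

Lemma uhp_scale (n : nat) z : (0 < n)%N -> uhp z -> uhp (n%:R * z).
Proof.
move=> n0; rewrite /uhp /=.
have -> : (n%:R : C) = mkC n%:R 0 by rewrite -[LHS](rmorph_nat (real_complex R)).
rewrite ImCM ReC_mkC ImC_mkC mul0r addr0 => zu.
by rewrite mulr_gt0// ltr0n.
Qed.

Lemma nrm_nat (n : nat) : nrm (n%:R : C) = n%:R.
Proof.
have -> : (n%:R : C) = mkC n%:R 0 by rewrite -[LHS](rmorph_nat (real_complex R)).
by rewrite nrm_mkC0 ger0_norm.
Qed.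

Lemma holomorphic_near_derive1 f z : (\near z, derivable f z 1) ->
  \near z, derivable (derive1 f) z 1.
Proof.
move=> /near_join; apply: filterS => w /nbhsCP[e e0 He].
exact: holomorphic_derive1 e0 He.
Qed.

(** The starting point may be a bad one: n z may be a pole of [h], or t(z) may be listed. Both
    defects disappear on a punctured disc, and t' stays nonzero there because it is continuous. *)
Lemma exists_good_point t h Pt Ph (n : nat) (s : seq C) :
  meromorphic_uhp t Pt -> meromorphic_uhp h Ph -> (0 < n)%N ->
  (exists z1 z2, uhp z1 /\ uhp z2 /\ ~ Pt z1 /\ ~ Pt z2 /\ t z1 != t z2) ->
  exists z, [/\ uhp z, ~ Pt z, ~ Ph (n%:R * z), derive1 t z != 0 & t z \notin s].
Proof.
move=> mt mh n0 /(exists_derive1_neq0 mt)[z [zu nP tz]].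
have [r1 r10 H1] := meromorphic_near mt zu nP.
have [r2 r20 H2] := poles_discrete mh (uhp_scale n0 zu).
have dz : derivable t z 1 by case: mt => _ [_ [+ _]]; apply.
have [r3 r30 H3] := near_avoid_values s (derivable_is_derive1 dz) tz.
have ct : {for z, continuous (derive1 t)}.
  by apply: derivable_continuous_at; apply: (holomorphic_derive1 r10) => w /H1[].
have [|d d0 Hd] := (continuousCP _ _).1 ct (nrm (derive1 t z)); first by rewrite nrm_gt0.
have n00 : 0 < n%:R :> R by rewrite ltr0n.
have nn0 : n%:R != 0 :> C by rewrite -nrm_gt0 nrm_nat.
(* The radius r2 is divided by n because multiplication by n stretches distances by n. *)
have [|w wz] := @exists_near_neq z (Num.min (Num.min r1 (r2 / n%:R)) (Num.min r3 d)).
  by rewrite !lt_min r10 r30 d0 divr_gt0.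
rewrite !lt_min => /andP[/andP[w1 w2] /andP[w3 w4]]; exists w.
have [uw nPw _] := H1 _ w1; split; [exact: uw|exact: nPw| | |exact: H3].
- apply: H2; last by rewrite (inj_eq (mulfI nn0)).
  by rewrite -mulrBr nrmM nrm_nat mulrC -ltr_pdivlMr.
- by apply: contraTneq (Hd _ w4) => ->; rewrite sub0r nrmN ltxx.
Qed.

End Meromorphic.

(** * The chain rule for the Schwarzian, and rational functions *)

Section Schwarzian.
Variable R : realType.
Local Open Scope complex_scope.
Local Notation C := (Cplx R).
Implicit Types (f g : C -> C) (z : C).

Lemma near_continuous g z (A : C -> Prop) : {for z, continuous g} ->
  (\forall w \near g z, A w) -> \near z, A (g z).
Proof. by move=> c H; exact: (c A H). Qed.

(** The Schwarzian as a function of the values f', f'', f''', which reduces the chain rule to an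
    identity in a field. *)
Definition schw (a b c : C) : C := (2 * a * c - 3 * b ^+ 2) / (2 * a ^+ 2).

Lemma schwE (a b c : C) : schw a b c = (2 * a * c - 3 * b ^+ 2) / (2 * a ^+ 2).
Proof. by []. Qed.

(** The three arguments on the left are the first three derivatives of a composite, with a, b, c
    those of the outer function and u, v, w those of the inner one. *)
Lemma schw_comp (a b c u v w : C) : a != 0 -> u != 0 ->
  schw (a * u) (b * u ^+ 2 + a * v) (c * u ^+ 3 + 3 * b * u * v + a * w) =
  schw a b c * u ^+ 2 + schw u v w.
Proof. by move=> a0 u0; rewrite !schwE; field; rewrite a0 u0. Qed.

Lemma near_eq_schwarzian f g z : (\near z, f z = g z) -> schwarzian f z = schwarzian g z.
Proof.
move=> E0; have E1 := near_eq_derive1 E0; have E2 := near_eq_derive1 E1.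
have E3 := near_eq_derive1 E2.
have e1 := nbhs_singleton E1; have e2 := nbhs_singleton E2.
have e3 := nbhs_singleton E3.
exact (f_equal3 schw e1 e2 e3).
Qed.

(** The first two derivatives are required near the point because they are differentiated again; the
    third only at the point. *)
Lemma schwarzian_comp_is_derive (f f1 f2 f3 g g1 g2 g3 : C -> C) z :
  (\forall w \near g z, is_derive (w : C) 1 f (f1 w)) ->
  (\forall w \near g z, is_derive (w : C) 1 f1 (f2 w)) ->
  is_derive (g z) 1 f2 (f3 (g z)) ->
  (\forall w \near z, is_derive (w : C) 1 g (g1 w)) ->
  (\forall w \near z, is_derive (w : C) 1 g1 (g2 w)) ->
  is_derive z 1 g2 (g3 z) ->
  f1 (g z) != 0 -> g1 z != 0 ->
  schwarzian (f \o g) z =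
  schw (f1 (g z)) (f2 (g z)) (f3 (g z)) * g1 z ^+ 2 + schw (g1 z) (g2 z) (g3 z).
Proof.
move=> hf hf1 df2 hg hg1 dg2 f1n g1n.
have cg : {for z, continuous g}.
  exact: derivable_continuous_at (is_derive_derivable (nbhs_singleton hg)).
have kf := near_continuous cg hf; have kf1 := near_continuous cg hf1.
have alg2 (a u b v : C) : a * u * u + b * v = a * u ^+ 2 + b * v by ring.
have alg3 (a b c u v w : C) : c * u * (u * u) + b * (v * u + u * v) + (b * u * v + a * w)
    = c * u ^+ 3 + 3 * b * u * v + a * w by ring.
have E1 : \near z, derive1 (f \o g) z = f1 (g z) * g1 z.
  apply: filterS2 kf hg => w df dg.
  exact: derive1_val (is_derive_chain df dg).
have E2 : \near z, derive1 (derive1 (f \o g)) z = f2 (g z) * g1 z ^+ 2 + f1 (g z) * g2 z.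
  have E2' : \near z, derive1 (fun w => f1 (g w) * g1 w) z =
      f2 (g z) * g1 z ^+ 2 + f1 (g z) * g2 z.
    apply: filterS3 hg hg1 kf1 => w dg dg1 df1; apply: derive1_val.
    apply: is_derive_eq (is_derive_prod (is_derive_chain df1 dg) dg1) _.
    exact: alg2.
  by apply: filterS2 (near_eq_derive1 E1) E2' => w -> ->.
have E3 : derive1 (derive1 (derive1 (f \o g))) z =
   f3 (g z) * g1 z ^+ 3 + 3 * f2 (g z) * g1 z * g2 z + f1 (g z) * g3 z.
  apply: etrans (nbhs_singleton (near_eq_derive1 E2)) _; apply: derive1_val.
  have dg := nbhs_singleton hg; have dg1 := nbhs_singleton hg1.
  have df1 := nbhs_singleton hf1.
  have h1 := is_derive_prod (is_derive_chain df2 dg) (is_derive_prod dg1 dg1).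
  have h2 := is_derive_prod (is_derive_chain df1 dg) dg2.
  apply: is_derive_eq (is_deriveD h1 h2) _.
  exact: alg3.
have e1 := nbhs_singleton E1; have e2 := nbhs_singleton E2.
apply: (etrans (f_equal3 schw e1 e2 E3)).
exact: schw_comp.
Qed.

Lemma near_is_derive1 f z : (\near z, derivable f z 1) ->
  \forall w \near z, is_derive (w : C) 1 f (derive1 f w).
Proof. by apply: filterS => w; exact: derivable_is_derive1. Qed.

(** Differentiability near a point passes to the derivative near that point; two applications supply
    all three orders. *)
Lemma schwarzian_comp f g z :
  (\forall w \near g z, derivable f w 1) -> (\near z, derivable g z 1) ->
  derive1 f (g z) != 0 -> derive1 g z != 0 ->
  schwarzian (f \o g) z = schwarzian f (g z) * derive1 g z ^+ 2 + schwarzian g z.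
Proof.
move=> hf hg f1n g1n.
have hf1 := holomorphic_near_derive1 hf; have hf2 := holomorphic_near_derive1 hf1.
have hg1 := holomorphic_near_derive1 hg; have hg2 := holomorphic_near_derive1 hg1.
have H := @schwarzian_comp_is_derive f (derive1 f) (derive1 (derive1 f))
  (derive1 (derive1 (derive1 f))) g (derive1 g) (derive1 (derive1 g))
  (derive1 (derive1 (derive1 g))) z.
exact (H (near_is_derive1 hf) (near_is_derive1 hf1)
  (derivable_is_derive1 (nbhs_singleton hf2)) (near_is_derive1 hg) (near_is_derive1 hg1)
  (derivable_is_derive1 (nbhs_singleton hg2)) f1n g1n).
Qed.

Lemma is_derive_scale (k z : C) : is_derive z 1 (fun w => k * w) k.
Proof.
have := is_derive_prod (is_derive_cst k z 1) (is_derive_id z 1).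
by rewrite mul0r add0r mulr1.
Qed.

Lemma schwarzian_scale (k z : C) : schwarzian (fun w => k * w) z = 0.
Proof.
have E1 : derive1 (fun w : C => k * w) = (fun=> k).
  by apply: funext => w; exact: derive1_val (is_derive_scale k w).
have d0 (c : C) : derive1 (fun=> c : C) = (fun=> 0).
  by apply: funext => w; exact: derive1_val (is_derive_cst c w 1).
by rewrite /schwarzian E1 !d0 expr0n !mulr0 subrr mul0r.
Qed.

End Schwarzian.

(** * Functions that are rational off the zeros of a polynomial *)

Section Rational.
Variable R : realType.
Local Open Scope complex_scope.
Local Notation C := (Cplx R).
Implicit Types (F G : C -> C) (D p q : {poly C}) (x : C).

Lemma is_derive_horner p x : is_derive x 1 (horner p) (p^`()).[x].
Proof.
elim/poly_ind: p => [|p c IH].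
  rewrite deriv0 horner0; have := is_derive_cst (0 : C) x 1.
  by congr is_derive; apply: funext => w; rewrite horner0.
rewrite derivMXaddC hornerD hornerMX.
have h := is_deriveD (is_derive_prod IH (is_derive_id x 1)) (is_derive_cst c x 1).
have E : horner (p * 'X + c%:P) = (fun w => p.[w] * w) + cst c.
  by apply: funext => w; rewrite hornerMXaddC.
rewrite E; apply: is_derive_eq h _.
by rewrite mulr1 addr0 addrC.
Qed.

Lemma horner_near_neq0 p x : p.[x] != 0 -> \near x, p.[x] != 0.
Proof.
move=> px; have c := derivable_continuous_at (is_derive_derivable (is_derive_horner p x)).
have [|d d0 Hd] := (continuousCP _ _).1 c (nrm p.[x]); first by rewrite nrm_gt0.
apply/nbhsCP; exists d => // w /Hd; apply: contraTneq => ->.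
by rewrite sub0r nrmN ltxx.
Qed.

Lemma is_derive_ratf p q x : q.[x] != 0 ->
  is_derive x 1 (ratf p q) ((p^`() * q - p * q^`()).[x] / (q ^+ 2).[x]).
Proof.
move=> qx; have h := is_derive_prod (is_derive_horner p x)
  (is_derive_inv qx (is_derive_horner q x)).
apply: is_derive_eq h _.
rewrite hornerD hornerN !hornerM.
have alg (a b c d : C) : b != 0 -> a * b^-1 + c * (- d / b ^+ 2) = (a * b - c * d) / (b * b).
  by move=> b0; field.
exact: alg.
Qed.

(** The exceptional set, the zeros of [D], stays fixed under algebraic operations and under
    [derive1], so rationality of a compound expression is proved piece by piece. *)
Definition rat_on D F := exists A B : {poly C},
  forall x, D.[x] != 0 -> B.[x] != 0 /\ F x = A.[x] / B.[x].

Lemma rat_onW D D' F : (forall x, D'.[x] != 0 -> D.[x] != 0) -> rat_on D F -> rat_on D' F.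
Proof. by move=> H [A [B HAB]]; exists A, B => x /H; exact: HAB. Qed.

Lemma eq_rat_on D F G : (forall x, D.[x] != 0 -> F x = G x) -> rat_on D F -> rat_on D G.
Proof.
move=> H [A [B HAB]]; exists A, B => x Dx; have [B0 FE] := HAB _ Dx.
by split=> //; rewrite -H.
Qed.

Lemma rat_on_cst D k : rat_on D (fun=> k).
Proof.
by exists k%:P, 1 => x _; rewrite !hornerE oner_eq0 divr1.
Qed.

Lemma rat_on_ratf p q : rat_on q (ratf p q).
Proof. by exists p, q. Qed.

Lemma rat_onD D F G : rat_on D F -> rat_on D G -> rat_on D (fun x => F x + G x).
Proof.
move=> [A [B H]] [A' [B' H']]; exists (A * B' + A' * B), (B * B') => x Dx.
have [B0 ->] := H _ Dx; have [B'0 ->] := H' _ Dx.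
rewrite hornerD !hornerM; split; first exact: mulf_neq0.
exact: addf_div.
Qed.

Lemma rat_onM D F G : rat_on D F -> rat_on D G -> rat_on D (fun x => F x * G x).
Proof.
move=> [A [B H]] [A' [B' H']]; exists (A * A'), (B * B') => x Dx.
have [B0 ->] := H _ Dx; have [B'0 ->] := H' _ Dx.
rewrite !hornerM; split; first exact: mulf_neq0.
exact: mulf_div.
Qed.

Lemma rat_onV D F : (forall x, D.[x] != 0 -> F x != 0) -> rat_on D F ->
  rat_on D (fun x => (F x)^-1).
Proof.
move=> F0 [A [B H]]; exists B, A => x Dx; have [B0 E] := H _ Dx.
have := F0 _ Dx; rewrite E mulf_eq0 negb_or => /andP[A0 _].
by rewrite invf_div.
Qed.

Lemma rat_on_horner D F p : rat_on D F -> rat_on D (fun x => p.[F x]).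
Proof.
move=> HF; elim/poly_ind: p => [|p c IH].
  by apply: eq_rat_on (rat_on_cst D 0) => x _; rewrite horner0.
apply: eq_rat_on (rat_onD (rat_onM IH HF) (rat_on_cst D c)) => x _.
by rewrite hornerMXaddC.
Qed.

(** The nonvanishing set of [D] is open, so F coincides with its quotient near each such point. *)
Lemma rat_on_derive1 D F : rat_on D F -> rat_on D (derive1 F).
Proof.
move=> [A [B H]]; exists (A^`() * B - A * B^`()), (B ^+ 2) => x Dx.
have [B0 _] := H _ Dx; split; first by rewrite horner_exp expf_neq0.
apply: derive1_val; apply: near_eq_is_derive1 (is_derive_ratf A B0).
by apply: filterS (horner_near_neq0 Dx) => w /H[_ ->].
Qed.

(** It turns a nonvanishing condition on F into one on a polynomial, which can then become a factor
    of [D]. *)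
Lemma rat_on_neq0 D F : rat_on D F ->
  exists A : {poly C}, forall x, D.[x] != 0 -> (F x != 0) = (A.[x] != 0).
Proof.
move=> [A [B H]]; exists A => x Dx; have [B0 ->] := H _ Dx.
by rewrite mulf_eq0 invr_eq0 negb_or B0 andbT.
Qed.

Lemma poly_roots p : p != 0 -> exists s : seq C, forall x, p.[x] = 0 -> x \in s.
Proof.
move=> p0; have [s E] := @closed_field_poly_normal (R[i]) p.
exists s => x; rewrite [p in p.[x]]E hornerZ => /eqP; rewrite mulf_eq0 lead_coef_eq0 (negbTE p0).
by have := root_prod_XsubC s x; rewrite /root => ->.
Qed.

(** The cross difference A B' - A' B vanishes at points outside every finite list, so it is the zero
    polynomial. *)
Lemma rat_on_identity D F G : rat_on D F -> rat_on D G ->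
  (forall s : seq C, exists x, [/\ x \notin s, D.[x] != 0 & F x = G x]) ->
  forall x, D.[x] != 0 -> F x = G x.
Proof.
move=> [A [B H]] [A' [B' H']] inf.
have [/eqP P0|/poly_roots[s Hs]] := eqVneq (A * B' - A' * B) 0.
  move=> x Dx; have [B0 ->] := H _ Dx; have [B'0 ->] := H' _ Dx.
  have := congr1 (fun p => p.[x]) (eqP P0); rewrite !hornerE => /eqP; rewrite subr_eq0.
  by move/eqP => E; apply/eqP; rewrite eqr_div//; apply/eqP.
have [x [xs Dx]] := inf s; have [B0 ->] := H _ Dx; have [B'0 ->] := H' _ Dx.
move/eqP; rewrite eqr_div// => /eqP E; case/negP: xs; apply: Hs.
by rewrite !hornerE E subrr.
Qed.

Lemma rat_on_schwarzian D F : (forall x, D.[x] != 0 -> derive1 F x != 0) ->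
  rat_on D F -> rat_on D (schwarzian F).
Proof.
move=> F0 h; have h1 := rat_on_derive1 h; have h2 := rat_on_derive1 h1.
have h3 := rat_on_derive1 h2.
have two0 : 2 != 0 :> C by rewrite pnatr_eq0.
have k x : D.[x] != 0 -> 2 * derive1 F x * derive1 F x != 0.
  by move=> /F0 Fx; rewrite !mulf_neq0.
have c2 := rat_on_cst D 2; have c3 := rat_on_cst D (- 3).
have h4 := rat_onM (rat_onD (rat_onM (rat_onM c2 h1) h3) (rat_onM c3 (rat_onM h2 h2)))
  (rat_onV k (rat_onM (rat_onM c2 h1) h1)).
have alg (a b c : C) : (2 * a * c + - 3 * (b * b)) * (2 * a * a)^-1 = schw a b c.
  by rewrite schwE !expr2 mulNr [2 * (a * a)]mulrA.
apply: eq_rat_on h4 => x _; exact: alg.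
Qed.

End Rational.

(** * The differential equations *)

Section Transfer.
Variable R : realType.
Local Open Scope complex_scope.
Local Notation C := (Cplx R).
Implicit Types (h t : C -> C) (z : C).

Lemma Qvalue_pullback h t (Ph Pt : set C) (QA QB QA' QB' : {poly C}) (k z : C) (r : C -> C) :
  Qvalue h Ph QA QB -> Qvalue t Pt QA' QB' ->
  k != 0 -> uhp z -> uhp (k * z) -> ~ Pt z -> ~ Ph (k * z) ->
  (\forall w \near z, derivable t w 1) -> (\forall w \near k * z, derivable h w 1) ->
  (\forall w \near t z, derivable r w 1) ->
  (\forall w \near z, h (k * w) = r (t w)) ->
  derive1 t z != 0 -> derive1 r (t z) != 0 -> QB'.[t z] != 0 -> QB.[r (t z)] != 0 ->
  (derive1 r (t z)) ^+ 2 * ratf QA QB (r (t z)) + 2^-1 * schwarzian r (t z) =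
  ratf QA' QB' (t z).
Proof.
move=> [_ Qh] [_ Qt] k0 zu kzu nPt nPh dt dh dr E t1 r1 QB'0 QB0.
have Ez : h (k * z) = r (t z) := nbhs_singleton E.
have dk : \forall w \near z, derivable (fun w => k * w) w 1.
  by near=> w; exact: is_derive_derivable (is_derive_scale k w).
have dk1 : derive1 (fun w => k * w) z = k := derive1_val (is_derive_scale k z).
have D1 : derive1 h (k * z) * k = derive1 r (t z) * derive1 t z.
  have e1 := derive1_val (is_derive_chain (f := h) (g := fun w => k * w)
    (derivable_is_derive1 (nbhs_singleton dh)) (is_derive_scale k z)).
  have e2 := derive1_val (is_derive_chain (derivable_is_derive1 (nbhs_singleton dr))
    (derivable_is_derive1 (nbhs_singleton dt))).
  apply: etrans (esym e1) (etrans _ e2).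
  exact: nbhs_singleton (near_eq_derive1 E).
have h1 : derive1 h (k * z) != 0.
  by have := mulf_neq0 r1 t1; rewrite -D1 mulf_eq0 negb_or => /andP[].
have kd : derive1 (fun w => k * w) z != 0 by rewrite dk1.
have S1 := schwarzian_comp (f := h) (g := fun w => k * w) dh dk h1 kd.
have S2 := schwarzian_comp dr dt r1 t1.
have S3 : schwarzian (h \o (fun w => k * w)) z = schwarzian (r \o t) z.
  exact: near_eq_schwarzian.
rewrite S3 S2 schwarzian_scale dk1 addr0 in S1.
have QBh : QB.[h (k * z)] != 0 by rewrite Ez.
have q1 := Qh _ kzu nPh h1 QBh; have q2 := Qt _ zu nPt t1 QB'0.
rewrite Ez in q1.
(* Here a = r', u = t', v = h', and s, s', s1 are the Schwarzians of r, t, h. After multiplication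
   by u^2 the claim is k^2 times the equation of [h] minus that of [t]. *)
have alg (a b u v s s' s1 q q' : C) : u != 0 -> v * k = a * u ->
    s * u ^+ 2 + s' = s1 * k ^+ 2 ->
    v ^+ 2 * q + 2^-1 * s1 = 0 -> u ^+ 2 * q' + 2^-1 * s' = 0 ->
    a ^+ 2 * q + 2^-1 * s = q'.
  move=> u0 e1 e2 e3 e4; apply: (mulIf (expf_neq0 2 u0)).
  have -> : (a ^+ 2 * q + 2^-1 * s) * u ^+ 2 =
    (a * u) ^+ 2 * q + 2^-1 * (s * u ^+ 2 + s') - 2^-1 * s' by ring.
  rewrite -e1 e2.
  have -> : (v * k) ^+ 2 * q + 2^-1 * (s1 * k ^+ 2) - 2^-1 * s' =
    k ^+ 2 * (v ^+ 2 * q + 2^-1 * s1) - (u ^+ 2 * q' + 2^-1 * s') + q' * u ^+ 2 by ring.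
  by rewrite e3 e4 mulr0 subrr add0r.
exact: (alg _ 0 _ _ _ _ _ _ _ t1 D1 S1 q1 q2).
Unshelve. all: by end_near.
Qed.

Lemma hauptmodul_transfer h t (Ph Pt : set C) (QA QB QA' QB' : {poly C}) (n : nat)
    (p q : {poly C}) :
  meromorphic_uhp h Ph -> meromorphic_uhp t Pt ->
  (exists z1 z2, uhp z1 /\ uhp z2 /\ ~ Pt z1 /\ ~ Pt z2 /\ t z1 != t z2) ->
  Qvalue h Ph QA QB -> Qvalue t Pt QA' QB' -> (0 < n)%N ->
  (forall z, uhp z -> ~ Pt z -> ~ Ph (n%:R * z) -> q.[t z] != 0 ->
     h (n%:R * z) = ratf p q (t z)) ->
  forall x, q.[x] != 0 -> QB'.[x] != 0 -> derive1 (ratf p q) x != 0 ->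
    QB.[ratf p q x] != 0 ->
    (derive1 (ratf p q) x) ^+ 2 * ratf QA QB (ratf p q x)
      + 2^-1 * schwarzian (ratf p q) x = ratf QA' QB' x.
Proof.
move=> mh mt nc Qh Qt n0 E x0 qx0 QB'x0 dx0 QBx0.
pose r := ratf p q.
have rr : rat_on q r by exact: rat_on_ratf.
have [W HW] := rat_on_neq0 (rat_on_derive1 rr).
have [B HB] := rat_on_neq0 (rat_on_horner QB rr).
(* One factor for each condition: q for the pole of r, W for r' = 0, B for the pole of Q at r(x),
   [QB'] for the pole of Q'. *)
pose D := q * W * B * QB'.
have DE x : D.[x] != 0 -> [/\ q.[x] != 0, derive1 r x != 0, QB.[r x] != 0 & QB'.[x] != 0].
  rewrite /D !hornerM !mulf_eq0 !negb_or => /andP[/andP[/andP[qx Wx] Bx] Q'x].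
  by split; [exact: qx|by rewrite (HW _ qx)|by rewrite (HB _ qx)|exact: Q'x].
have Dx0 : D.[x0] != 0.
  rewrite /D !hornerM; apply: mulf_neq0; last exact: QB'x0.
  apply: mulf_neq0; last first.
    by rewrite -(HB _ qx0); exact: QBx0.
  by apply: mulf_neq0; [exact: qx0|rewrite -(HW _ qx0); exact: dx0].
have rD : rat_on D r by apply: rat_onW rr => x /DE[].
have dD x : D.[x] != 0 -> derive1 r x != 0 by move=> /DE[].
have hr1 := rat_on_derive1 rD.
have lhs : rat_on D (fun x => derive1 r x ^+ 2 * ratf QA QB (r x) + 2^-1 * schwarzian r x).
  have QBV : rat_on D (fun x => (QB.[r x])^-1).
    by apply: rat_onV (rat_on_horner QB rD) => x /DE[].
  apply: rat_onD; last exact: (rat_onM (rat_on_cst _ _) (rat_on_schwarzian dD rD)).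
  apply: rat_onM; first exact: (rat_onM hr1 hr1).
  exact: (rat_onM (rat_on_horner QA rD) QBV).
have rhs : rat_on D (ratf QA' QB').
  by apply: rat_onW (rat_on_ratf QA' QB') => x /DE[].
apply: (rat_on_identity lhs rhs _ Dx0) => s.
have Dn0 : D != 0 by apply: contraNneq Dx0 => ->; rewrite horner0.
(* The roots of D join the values to avoid, so that D is nonzero at t(z). *)
have [s' Hs'] := poly_roots Dn0.
have [z [zu nPt nPh t1 zs]] := exists_good_point (s ++ s') mt mh n0 nc.
rewrite mem_cat negb_or in zs; case/andP: zs => zs zs'.
have Dz : D.[t z] != 0 by apply: contra zs' => /eqP; exact: Hs'.
exists (t z); split; [exact: zs|exact: Dz|].
have [qz rz QBz QB'z] := DE _ Dz.
have nzu := uhp_scale n0 zu.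
have nn0 : n%:R != 0 :> C by rewrite pnatr_eq0 -lt0n.
have [e1 e10 H1] := meromorphic_near mt zu nPt.
have [e2 e20 H2] := meromorphic_near mh nzu nPh.
have dt : \forall w \near z, derivable t w 1.
  by apply/nbhsCP; exists e1 => // w /H1[].
have dh : \forall w \near n%:R * z, derivable h w 1.
  by apply/nbhsCP; exists e2 => // w /H2[].
have dr : \forall w \near t z, derivable r w 1.
  by apply: filterS (horner_near_neq0 qz) => w qw; exact: is_derive_derivable (is_derive_ratf p qw).
apply: (Qvalue_pullback Qh Qt nn0 zu nzu nPt nPh dt dh dr _ t1 rz QB'z QBz).
have ct := derivable_continuous_at (nbhs_singleton dt).
have ck := derivable_continuous_at (is_derive_derivable (is_derive_scale n%:R z)).
have a1 : \forall w \near z, uhp w /\ ~ Pt w.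
  by apply/nbhsCP; exists e1 => // w /H1[].
have a2 : \forall w \near z, ~ Ph (n%:R * w).
  apply: (near_continuous (A := fun v => ~ Ph v) ck).
  by apply/nbhsCP; exists e2 => // w /H2[].
have a3 : \forall w \near z, q.[t w] != 0.
  exact: (near_continuous (A := fun v => q.[v] != 0) ct (horner_near_neq0 qz)).
by apply: filterS3 a1 a2 a3 => w [uw nPw] nPw' qw; exact: E.
Qed.

End Transfer.

Theorem theorem5 (R : realType) (G G' : set 'M[R]_2)
  (h t : Cplx R -> Cplx R) (Ph Pt : set (Cplx R))
  (QA QB QA' QB' : {poly Cplx R}) (n : nat)
  (p1 q1 p2 q2 : {poly Cplx R}) :
  modular_group G -> modular_group G' ->
  genus_zero G -> genus_zero G' ->
  hauptmodul G h Ph -> hauptmodul G' t Pt ->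
  Qvalue h Ph QA QB -> Qvalue t Pt QA' QB' ->
  (0 < n)%N ->
  q1 != 0 -> q2 != 0 ->
  (* h(tau) = h1(t(tau)) with h1 = p1/q1 *)
  (forall z, uhp z -> ~ Pt z -> ~ Ph z -> q1.[t z] != 0 ->
     h z = ratf p1 q1 (t z)) ->
  (* h(n tau) = h2(t(tau)) with h2 = p2/q2 *)
  (forall z, uhp z -> ~ Pt z -> ~ Ph (n%:R * z) -> q2.[t z] != 0 ->
     h (n%:R * z) = ratf p2 q2 (t z)) ->
  (* identity of rational functions in t, checked at every point where
     all terms are defined *)
  forall x : Cplx R,
    q1.[x] != 0 -> q2.[x] != 0 -> QB'.[x] != 0 ->
    derive1 (ratf p1 q1) x != 0 -> derive1 (ratf p2 q2) x != 0 ->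
    QB.[ratf p1 q1 x] != 0 -> QB.[ratf p2 q2 x] != 0 ->
    (derive1 (ratf p1 q1) x) ^+ 2 * ratf QA QB (ratf p1 q1 x)
      + 2^-1 * schwarzian (ratf p1 q1) x = ratf QA' QB' x /\
    (derive1 (ratf p2 q2) x) ^+ 2 * ratf QA QB (ratf p2 q2 x)
      + 2^-1 * schwarzian (ratf p2 q2) x = ratf QA' QB' x.
Proof.
move=> _ _ _ _ [[mh _] _] [[mt _] [nc _]] Qh Qt n0 _ _ E1 E2 x q1x q2x Q'x d1 d2 B1 B2.
split.
  (* The expression of [h] itself is the scaling by n = 1. *)
  apply: (hauptmodul_transfer (n := 1) mh mt nc Qh Qt) => //.
  by move=> z; rewrite mul1r; exact: E1.
exact: (hauptmodul_transfer mh mt nc Qh Qt n0 E2).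
Qed.
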